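(* Consider $N$ point-like scatterers at $\vec y_j=(y_j,L+\eta_j)$ with symmetric polarizability tensors $\boldsymbol\alpha_j\in\mathbb C^{3\times3}$, $\|\boldsymbol\alpha_j\|=\mathcal O(1)$, $j=1,\dots,N$. In the Fraunhofer asymptotic regime, the system $$\mathbb H_{1:2,1:2}(\vec y,\vec y;k)\,\boldsymbol\alpha_{1:2,1:2}\,\mathbb H_{1:2,1:2}(\vec y,\vec y;k)=\mathbb I_{\mathrm{KM};1:2,1:2}(\vec y;k)$$ for the unknown $\boldsymbol\alpha_{1:2,1:2}\in\mathbb C^{2\times2}$ is invertible and its solution is $$\boldsymbol\alpha_{1:2,1:2}=\mathbb H_{1:2,1:2}(\vec y,\vec y;k)^{-1}\,\mathbb I_{\mathrm{KM};1:2,1:2}(\vec y;k)\,\mathbb H_{1:2,1:2}(\vec y,\vec y;k)^{-1}.$$ If the array $\mathcal A$ is a disk of radius $a$, the estimated cross-range polarizability tensor $\boldsymbol\alpha_{1:2,1:2}$ (which depends on the imaging point $\vec y=(y,L+\eta)$) approximates the exact one in the following sense. (i) If the imaging point coincides with a scatterer, i.e. $\vec y=\vec y_i$, then $$\|\boldsymbol\alpha_{1:2,1:2}-\boldsymbol\alpha_{i;1:2,1:2}\|=\mathcal O\Big(\Big(\frac{L}{a\,k\,\min_{j\ne i}\|y_i-y_j\|}\Big)^2\Big)+\mathcal O\Big(\frac bL\Big)+\mathcal O\Big(\frac{a^2\Theta_a}{L^2}\Big)+\mathcal O(\Theta_b).$$ (ii) If $y\ne y_j$ for all $j=1,\dots,N$,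 then $$\|\boldsymbol\alpha_{1:2,1:2}\|=\mathcal O\Big(\Big(\frac{L}{a\,k\,\min_{j=1,\dots,N}\|y-y_j\|}\Big)^2\Big)+\mathcal O\Big(\frac{a^4\Theta_a^2}{L^4}\Big)+\mathcal O(\Theta_b^2).$$
   Context: Notation. Points of $\mathbb R^3$ are written $\vec x=(x,z)$ with $x\in\mathbb R^2$ the cross-range part and $z$ the range part; $k>0$ is the wavenumber. With $\vec r=\vec x-\vec y$, $r=\|\vec r\|$, $m(kr)=(\mathrm i kr-1)/(kr)^2$, and $G(\vec x,\vec y;k)=\frac{e^{\mathrm i k\|\vec x-\vec y\|}}{4\pi\|\vec x-\vec y\|}$, the dyadic Green function is the $3\times3$ matrix $$\mathbb G(\vec x,\vec y;k)=G(\vec x,\vec y;k)\Big[(1+m(kr))\mathbb I-(1+3m(kr))\frac{\vec r\,\vec r^{\top}}{r^2}\Big].$$ Array, data, image. The array of collocated sources and receivers is $\mathcal A\subset\mathbb R^2$ of characteristic size $a$, i.e. $\mathcal A=a\widetilde{\mathcal A}$ with $\widetilde{\mathcal A}\subset\mathbb R^2$ a fixed nonempty bounded domain (a disk array of radius $a$ is $\{x_r\in\mathbb R^2:\|x_r\|\le a\}$); receivers and sources are $\vec x_r=(x_r,0)$, $\vec x_s=(x_s,0)$ with $x_r,x_s\in\mathcal A$. The data are the array response function (Born approximation) $\Pi(x_r,x_s;k)=\sum_{n=1}^N\mathbb G(\vec x_r,\vec y_n;k)\,\boldsymbol\alpha_n\,\mathbb G(\vec y_n,\vec x_s;k)$,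 and the active Kirchhoff imaging function is the $3\times3$ matrix $$\mathbb I_{\mathrm{KM}}(\vec y;k)=\int_{\mathcal A}\int_{\mathcal A}\overline{\mathbb G(\vec x_r,\vec y;k)}\,\Pi(x_r,x_s;k)\,\overline{\mathbb G(\vec x_s,\vec y;k)}\,\mathrm dx_r\,\mathrm dx_s=\sum_{n=1}^N\mathbb H(\vec y,\vec y_n;k)\,\boldsymbol\alpha_n\,\mathbb H(\vec y,\vec y_n;k)^{\top},$$ where $\mathbb H(\vec y,\vec y';k)=\int_{\mathcal A}\overline{\mathbb G(\vec x_r,\vec y;k)}\,\mathbb G(\vec x_r,\vec y';k)\,\mathrm dx_r$. The subscript $1{:}2,1{:}2$ on a $3\times 3$ matrix denotes its leading $2\times2$ principal block ($\boldsymbol\alpha_{i;1:2,1:2}$ is that of $\boldsymbol\alpha_i$). Fraunhofer regime. Imaging points and scatterer positions lie in the imaging window: they are of the form $(y,L+\eta)$ with $\|y\|=\mathcal O(b)$ and $|\eta|=\mathcal O(h)$. Put $\Theta_a=ka^2/L$, $\Theta_b=kb^2/L$, $\Theta_h=kh^2/L$. The parameters $(k,L,a,b,h)$ vary so that $kL\gg1$, $a\ll L$, $b\ll L$, $h\ll L$, $\Theta_b\ll1$, $1\ll\Theta_a\ll L^2/a^2$ and $kh=\mathcal O(1)$, where $X\ll Y$ means $X/Y\to0$; $N$ is fixed. ''In the Fraunhofer regime'' means sufficiently far along this limit, and $\mathcal O$, $o$ refer to this limit, uniformly over points of the imaging window. The term with $\min_{j\ne i}$ is absent if $N=1$, and the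 estimate in (i) is understood for scatterers with $y_j\ne y_i$, $j\neq i$ (it is void otherwise). *)

(* Defs.v *)
From HB Require Import structures.
From mathcomp Require Import all_boot all_order all_algebra.
From mathcomp Require Import all_classical all_reals all_analysis.
From mathcomp Require Import complex.

Set Implicit Arguments.
Unset Strict Implicit.
Unset Printing Implicit Defensive.

Import Order.TTheory GRing.Theory Num.Theory.
Import numFieldNormedType.Exports.

Local Open Scope classical_set_scope.
Local Open Scope ring_scope.
Local Open Scope complex_scope.

Section Norms.
Context {R : realType}.

(* The library norm on [R * R] is the sup norm. *)
Definition norm2 (x : R * R) : R := Num.sqrt (x.1 ^+ 2 + x.2 ^+ 2).

Definition norm3 (v : 'cV[R]_3) : R := Num.sqrt (\sum_i v i 0 ^+ 2).

(* Frobenius norm; all norms on a space of fixed-size matrices being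
   equivalent, the choice only affects the constants in the O's. *)
Definition mxnorm m n (M : 'M[R[i]]_(m, n)) : R :=
  Num.sqrt (\sum_i \sum_j Normc.normc (M i j) ^+ 2).

End Norms.

Section Kirchhoff.
Context {R : realType}.
Local Notation C := R[i].

Definition point3 (x : R * R) (z : R) : 'cV[R]_3 :=
  \col_i nth 0 [:: x.1; x.2; z] i.

Definition expi (t : R) : C := cos t +i* sin t.

Definition green (k : R) (x y : 'cV[R]_3) : C :=
  expi (k * norm3 (x - y)) / (4 * pi * norm3 (x - y))%:C.

Definition mfactor (s : R) : C := (-1 +i* s) / (s ^+ 2)%:C.

Definition dyadic_green (k : R) (x y : 'cV[R]_3) : 'M[C]_3 :=
  let r := x - y in
  let m := mfactor (k * norm3 r) in
  green k x y *:
    ((1 + m)%:M - (1 + 3 * m) *: map_mx (real_complex R)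
                                   ((norm3 r ^+ 2)^-1 *: (r *m r^T))).

Definition conj_mx n p (M : 'M[C]_(n, p)) : 'M[C]_(n, p) :=
  map_mx (@conjc R) M.

Local Notation lebesgue2 := (@lebesgue_measure R \x @lebesgue_measure R)%E.

Definition cintegral (A : set (R * R)) (f : R * R -> C) : C :=
  (\int[lebesgue2]_(x in A) complex.Re (f x))
    +i* (\int[lebesgue2]_(x in A) complex.Im (f x)).

Definition mxintegral n p (A : set (R * R)) (f : R * R -> 'M[C]_(n, p)) :
    'M[C]_(n, p) :=
  \matrix_(i, j) cintegral A (fun x => f x i j).

Definition Hmx (A : set (R * R)) (k : R) (y y' : 'cV[R]_3) : 'M[C]_3 :=
  mxintegral A (fun xr =>
    conj_mx (dyadic_green k (point3 xr 0) y) *m dyadic_green k (point3 xr 0) y').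

Definition born_data N (k : R) (ys : 'I_N -> 'cV[R]_3)
    (alpha : 'I_N -> 'M[C]_3) (xr xs : R * R) : 'M[C]_3 :=
  \sum_n dyadic_green k (point3 xr 0) (ys n) *m alpha n
           *m dyadic_green k (ys n) (point3 xs 0).

Definition kirchhoff_image N (A : set (R * R)) (k : R)
    (ys : 'I_N -> 'cV[R]_3) (alpha : 'I_N -> 'M[C]_3) (y : 'cV[R]_3) :
    'M[C]_3 :=
  mxintegral A (fun xr => mxintegral A (fun xs =>
    conj_mx (dyadic_green k (point3 xr 0) y)
      *m born_data k ys alpha xr xs
      *m conj_mx (dyadic_green k (point3 xs 0) y))).

Definition block12 (M : 'M[C]_3) : 'M[C]_2 := @ulsubmx C 2 1 2 1 M.

Definition estimated_tensor N (A : set (R * R)) (k : R)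
    (ys : 'I_N -> 'cV[R]_3) (alpha : 'I_N -> 'M[C]_3) (y : 'cV[R]_3) :
    'M[C]_2 :=
  let H := block12 (Hmx A k y y) in
  invmx H *m block12 (kirchhoff_image A k ys alpha y) *m invmx H.

End Kirchhoff.

Section Arrays.
Context {R : realType}.

(* A bounded planar domain, i.e. a nonempty connected open set, or the closure
   of one: disk arrays are closed. *)
Definition bounded_domain (A : set (R * R)) : Prop :=
  bounded_set A /\
  exists U : set (R * R),
    [/\ U !=set0, open U, connected U & A = U \/ A = closure U].

Definition scaled_array (a : R) (A : set (R * R)) : set (R * R) :=
  [set (a * x.1, a * x.2) | x in A].

Definition disk (a : R) : set (R * R) := [set x | norm2 x <= a].

End Arrays.

Section Regime.
Context {R : realType}.

Definition much_less (T : Type) (F : set_system T) (X Y : T -> R) : Prop :=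
  (X t / Y t) @[t --> F] --> (0 : R).

Definition Theta (k L s : R) : R := k * s ^+ 2 / L.

Definition fraunhofer (T : Type) (F : set_system T) (k L a b h : T -> R) :
    Prop :=
  let one := fun=> 1 : R in
  let Theta_a := fun t => Theta (k t) (L t) (a t) in
  let Theta_b := fun t => Theta (k t) (L t) (b t) in
  [/\ [/\ forall t, 0 < k t, forall t, 0 < L t, forall t, 0 < a t,
          forall t, 0 < b t & forall t, 0 < h t],
      [/\ much_less F one (fun t => k t * L t), much_less F a L,
          much_less F b L & much_less F h L],
      [/\ much_less F Theta_b one, much_less F one Theta_a
        & much_less F Theta_a (fun t => L t ^+ 2 / a t ^+ 2)]
    & exists c : R, \forall t \near F, `|k t * h t| <= c].

(* Window points (y, L + eta), with the constants implicit in
   ||y|| = O(b) and |eta| = O(h) made explicit. *)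
Definition in_window (cb ch b h : R) (y : R * R) (eta : R) : Prop :=
  norm2 y <= cb * b /\ `|eta| <= ch * h.

(* (L / (a k min_(j | P j) ||y - ys j||))^2, absent (that is, 0) if there is
   no index j with P j. *)
Definition resolution_term N (k L a : R) (y : R * R) (ys : 'I_N -> R * R)
    (P : pred 'I_N) : R :=
  if [pick j | P j] is Some j0 then
    (L / (a * k * \big[Num.min/norm2 (y - ys j0)]_(j | P j) norm2 (y - ys j)))
      ^+ 2
  else 0.

End Regime.

(* Main.v *)
(* Divide H by its leading diagonal value |A| / (4 pi L)^2, and measure lengths
   in units of L. Pointwise on the array, the bracket in the Green tensor is
   [[1, 0, x1], [0, 1, x2], [x1, x2, 0]] up to O(E), where
   E = Theta_b + a^2 Theta_a / L^2 + b / L, and the phase difference between two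
   window points is affine in x up to O(E). The cross-range rows of the
   normalized H are therefore, up to O(E), averages over the array of a plane
   wave of frequency k (y' - y) / L against affine weights.
   - If y = y' the wave is constant; the cross-range block is I + O(E), and on a
     disk the weights x1, x2 average to zero, so the third column is O(E).
   - If y <> y', integrating along slices of the disk in the coordinate direction
     of larger frequency bounds the average by O(L / (a k |y - y'|)).
   Since I_KM is the sum over n of H alpha_n H^T, (i) and (ii) follow from
   perturbation bounds for 2 x 2 matrices; in (i) the scatterers n <> i enter
   quadratically. *)

Require Import Defs.
From HB Require Import structures.
From mathcomp Require Import all_boot all_order all_algebra.
From mathcomp Require Import all_classical all_reals all_analysis.
From mathcomp Require Import measurable_realfun complex ring lra.

Set Implicit Arguments.
Unset Strict Implicit.
Unset Printing Implicit Defensive.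

Import Order.TTheory GRing.Theory Num.Theory.
Import numFieldNormedType.Exports.

Local Open Scope classical_set_scope.
Local Open Scope ring_scope.

(** * Integration over the plane *)

(* [plane R] is [R * R] with the sigma-algebra that carries the product of
   Lebesgue measures; the instance found on [R * R] itself differs from it by
   its display. *)
Notation plane R := (measurableTypeR R * measurableTypeR R)%type.
Notation lebesgue2 R := (@lebesgue_measure R \x @lebesgue_measure R)%E.

Section PlaneIntegrals.
Context {R : realType}.
Implicit Types (A : set (plane R)) (f g : plane R -> R).

(** All estimates are inequalities at one value of the parameters, with explicit numerical
    constants; the limit enters only to make [E] small. This works because [E] dominates every other
    small quantity. Since a^2 Theta_a / L^2 = Theta_a^2 / (kL) and Theta_a >= 1 eventually, both a^2
    / L^2 and 1 / (kL) are at most a^2 Theta_a / L^2, and kh = O(1) turns h / L into O(1 / (kL)).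
    Near-field terms, range offsets and amplitude variations are thus absorbed.

    The ratio a / L is the exception: only its square is O(E). The entries x1, x2 coupling range and
    cross-range must therefore be kept in the limiting kernel, and at y = y' they disappear only by
    the symmetry of the disk. Invertibility sees the cross-range block alone, so it holds for every
    array; (i) involves the range column of H, through which the remaining entries of the
    polarizability enter.

    Distances are not Taylor expanded: a difference of square roots is rewritten as a difference of
    squares over a sum, which keeps all remainders polynomial. *)

Lemma open_measurable2 (U : set (R * R)) : open U -> @measurable _ (plane R) U.
Proof.
move=> oU.
pose box (q : (rat * rat) * (rat * rat)) : set (R * R) :=
  `]ratr q.1.1 : R, ratr q.1.2 : R[%classic `*`
  `]ratr q.2.1 : R, ratr q.2.2 : R[%classic.
(* The inclusion of a rational box in [U] does not depend on the point, so each set of this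
   countable union is either the box or empty. *)
have -> : U = \bigcup_(p in [set: rat]) \bigcup_(q in [set: rat])
    \bigcup_(r in [set: rat]) \bigcup_(s in [set: rat])
      [set x | box ((p, q), (r, s)) `<=` U /\ box ((p, q), (r, s)) x].
  apply/seteqP; split=> [[x y] Uxy|z [p _ [q _ [r _ [s _ [+ +]]]]]]; last exact.
  have /nbhs_ballP[e e0 eU] := open_nbhs_nbhs (conj oU Uxy).
  have [p] : exists p : rat, ratr p \in `]x - e, x[
    by apply: rat_in_itvoo; rewrite ltrBlDr ltrDl.
  have [q] : exists p : rat, ratr p \in `]x, x + e[
    by apply: rat_in_itvoo; rewrite ltrDl.
  have [r] : exists p : rat, ratr p \in `]y - e, y[
    by apply: rat_in_itvoo; rewrite ltrBlDr ltrDl.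
  have [s] : exists p : rat, ratr p \in `]y, y + e[
    by apply: rat_in_itvoo; rewrite ltrDl.
  rewrite !in_itv/= => /andP[ys sy] /andP[ry yr] /andP[xq qx] /andP[px xp].
  exists p => //; exists q => //; exists r => //; exists s => //; split; last first.
    by split=> /=; rewrite in_itv/= ?xp ?xq ?yr ?ys.
  move=> [u v] [/=]; rewrite !in_itv/= => /andP[pu uq] /andP[rv vs].
  by apply: eU; split; rewrite /ball/= ltr_norml; apply/andP; split; lra.
apply: bigcupT_measurable_rat => p; apply: bigcupT_measurable_rat => q.
apply: bigcupT_measurable_rat => r; apply: bigcupT_measurable_rat => s.
have [bU|nbU] := pselect (box ((p, q), (r, s)) `<=` U).
  rewrite (_ : [set x | _] = box ((p, q), (r, s))); first exact: measurableX.
  by apply/seteqP; split=> // x [].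
rewrite (_ : [set x | _] = set0); first exact: measurable0.
by apply/seteqP; split=> // x [].
Qed.

Lemma closed_measurable2 (A : set (R * R)) : closed A -> @measurable _ (plane R) A.
Proof. by move=> /closed_openC/open_measurable2/measurableC; rewrite setCK. Qed.

(** Measurability is global but boundedness is required on [A] only: sums, products and compositions
    then need no care about domains, while the coordinate functions, unbounded on the plane, still
    qualify when [A] is bounded. *)
Definition bounded_measurable A f : Prop :=
  measurable_fun setT f /\ exists B, forall x, A x -> `|f x| <= B.

Lemma bounded_measurableD A f g : bounded_measurable A f ->
  bounded_measurable A g -> bounded_measurable A (fun x => f x + g x).
Proof.
move=> [mf [B fB]] [mg [B' gB]]; split; first exact: measurable_funD.
exists (B + B') => x Ax; rewrite (le_trans (ler_normD _ _))//.
by apply: lerD; [exact: fB|exact: gB].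
Qed.

Lemma bounded_measurableM A f g : bounded_measurable A f ->
  bounded_measurable A g -> bounded_measurable A (fun x => f x * g x).
Proof.
move=> [mf [B fB]] [mg [B' gB]]; split; first exact: measurable_funM.
by exists (B * B') => x Ax; rewrite normrM ler_pM// ?fB ?gB.
Qed.

Lemma bounded_measurable_cst A (c : R) : bounded_measurable A (fun=> c).
Proof. by split; [exact: measurable_cst|exists `|c| => x _]. Qed.

Lemma bounded_measurableN A f : bounded_measurable A f ->
  bounded_measurable A (fun x => - f x).
Proof.
move=> [mf [B fB]]; split; first exact: measurable_funN.
by exists B => x Ax; rewrite normrN fB.
Qed.

Lemma bounded_measurableB A f g : bounded_measurable A f ->
  bounded_measurable A g -> bounded_measurable A (fun x => f x - g x).
Proof.
by move=> mf mg; apply: bounded_measurableD => //; exact: bounded_measurableN.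
Qed.

Lemma bounded_measurable_integrable A f : measurable A ->
  (lebesgue2 R A < +oo)%E -> bounded_measurable A f ->
  (lebesgue2 R).-integrable A (EFin \o f).
Proof.
move=> mA Aoo [mf [B fB]]; apply: measurable_bounded_integrable => //.
  exact: measurable_funTS.
exists B; split; first exact: num_real.
by move=> x Bx y Ay; apply: le_trans (fB _ Ay) _; exact: ltW.
Qed.

Lemma normr_Rintegral_le A f (B : R) : measurable A ->
  (lebesgue2 R A < +oo)%E -> measurable_fun setT f ->
  (forall x, A x -> `|f x| <= B) ->
  `|\int[lebesgue2 R]_(x in A) f x| <= B * fine (lebesgue2 R A).
Proof.
move=> mA Aoo mf fB.
have bf : bounded_measurable A f by split => //; exists B.
have ifA := bounded_measurable_integrable mA Aoo bf.
rewrite -(@Rintegral_cst _ _ _ (lebesgue2 R) A mA).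
apply: (le_trans (le_normr_Rintegral mA ifA)).
apply: le_Rintegral => //.
  by apply: (bounded_measurable_integrable mA Aoo); split;
    [exact: measurableT_comp|exists B => x Ax; rewrite normr_id fB].
by apply: (bounded_measurable_integrable mA Aoo); exact: bounded_measurable_cst.
Qed.

Lemma lebesgue_itvNcc (a : R) : 0 <= a ->
  lebesgue_measure `[- a, a]%classic = (2 * a)%:E.
Proof.
move=> a0; rewrite lebesgue_measure_itv/= lte_fin.
by case: ifPn => [_|]; [rewrite -EFinD|rewrite -leNgt => ?]; congr EFin; lra.
Qed.

Let restrict_integrable A f : measurable A -> (lebesgue2 R A < +oo)%E ->
  bounded_measurable A f ->
  (lebesgue2 R).-integrable setT (EFin \o (f \_ A)).
Proof.
move=> mA Aoo bf; have := bounded_measurable_integrable mA Aoo bf.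
by move=> /(integrable_mkcond _ mA); rewrite restrict_EFin.
Qed.

Let strip_bound (F : R -> \bar R) (a B : R) : 0 <= a -> 0 <= B ->
  measurable_fun setT (F : measurableTypeR R -> \bar R) ->
  (forall x, (`|F x| <= (B * \1_(`[- a, a]%classic) x)%:E)%E) ->
  `|fine (\int[lebesgue_measure]_x F x)%E| <= 2 * a * B.
Proof.
move=> a0 B0 mF FB; rewrite -lee_fin.
have -> : (2 * a * B)%:E = (\int[lebesgue_measure]_x (B * \1_(`[- a, a]%classic) x)%:E)%E.
  under eq_integral do rewrite EFinM.
  rewrite ge0_integralZl//=; last first.
    by apply/measurable_EFinP; exact: measurable_indic.
  by rewrite integral_indic//= setIT lebesgue_itvNcc// -EFinM mulrC.
(* [fine] sends infinite values to 0, so this comparison does not require the integral to be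
   finite. *)
apply: (@le_trans _ _ (`|\int[lebesgue_measure]_x F x|)%E).
  by case: (integral _ _ _) => [r| |] //=; rewrite ?normr0 ?leey.
apply: le_trans (le_abse_integral _ _ mF) _ => //.
apply: ge0_le_integral => //; first exact: measurableT_comp.
by apply/measurable_EFinP/measurable_funM => //; exact: measurable_indic.
Qed.

(** Fubini with the inner integral estimated first: cancellation is exploited along the second
    coordinate, and the first contributes only its width [2 * a]. The companion lemma exchanges the
    coordinates. *)
Lemma normr_Rintegral_strip1 A f (a B : R) : measurable A ->
  (lebesgue2 R A < +oo)%E -> bounded_measurable A f -> 0 <= a -> 0 <= B ->
  (forall x, (`|\int[lebesgue_measure]_y ((f \_ A) (x, y))%:E|
                <= (B * \1_(`[- a, a]%classic) x)%:E)%E) ->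
  `|\int[lebesgue2 R]_(x in A) f x| <= 2 * a * B.
Proof.
move=> mA Aoo bf a0 B0 FB; rewrite Rintegral_mkcond /Rintegral.
have intf := restrict_integrable mA Aoo bf.
rewrite -(integral12_prod_meas1 intf); apply: strip_bound => //.
exact: (measurable_fubini_F intf).
Qed.

Lemma normr_Rintegral_strip2 A f (a B : R) : measurable A ->
  (lebesgue2 R A < +oo)%E -> bounded_measurable A f -> 0 <= a -> 0 <= B ->
  (forall y, (`|\int[lebesgue_measure]_x ((f \_ A) (x, y))%:E|
                <= (B * \1_(`[- a, a]%classic) y)%:E)%E) ->
  `|\int[lebesgue2 R]_(x in A) f x| <= 2 * a * B.
Proof.
move=> mA Aoo bf a0 B0 FB; rewrite Rintegral_mkcond /Rintegral.
have intf := restrict_integrable mA Aoo bf.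
rewrite -(integral21_prod_meas1 intf); apply: strip_bound => //.
exact: (measurable_fubini_G intf).
Qed.

End PlaneIntegrals.

(** * Oscillatory integrals over a disk *)

Section OscillatoryIntegrals.
Context {R : realType}.

Lemma is_derive_continuous (f df : R -> R) :
  (forall x : R, is_derive x 1 f (df x)) -> continuous f.
Proof.
move=> dfE x; apply: differentiable_continuous; apply/derivable1_diffP.
by case: (dfE x).
Qed.

Lemma integral_is_derive (f F : R -> R) (a b : R) : a <= b -> continuous f ->
  (forall x : R, is_derive x 1 F (f x)) ->
  (\int[lebesgue_measure]_(x in `[a, b]) (f x)%:E = (F b - F a)%:E)%E.
Proof.
(* The fundamental theorem asks for a < b, but slices at the edge of the disk reduce to a point. *)
rewrite le_eqVlt => /predU1P[-> _ _|ab cf dF].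
  by rewrite set_itv1 integral_set1 subrr.
have cF := is_derive_continuous dF.
rewrite (@continuous_FTC2 _ f F)//.
- exact: continuous_subspaceT.
- split; first by move=> x _; case: (dF x).
  + exact/cvg_at_right_filter/cF.
  + exact/cvg_at_left_filter/cF.
- by move=> x _; rewrite derive1E; case: (dF x).
Qed.

Lemma is_derive_affine (b c x : R) : is_derive x 1 (fun s => b + c * s) c.
Proof.
have := is_deriveD (is_derive_cst b x 1) (is_deriveZ c (is_derive_id x 1)).
by move=> /is_derive_eq; apply; rewrite add0r /GRing.scale/= mulr1.
Qed.

Lemma is_derive_sin_affine (b c x : R) :
  is_derive x 1 (fun s => sin (b + c * s)) (cos (b + c * x) * c).
Proof.
exact: (@is_derive1_comp _ sin _ _ _ _ (is_derive_sin _) (is_derive_affine b c x)).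
Qed.

Lemma is_derive_cos_affine (b c x : R) :
  is_derive x 1 (fun s => cos (b + c * s)) (- sin (b + c * x) * c).
Proof.
exact: (@is_derive1_comp _ cos _ _ _ _ (is_derive_cos _) (is_derive_affine b c x)).
Qed.

Lemma cosB_le (x y : R) : `|cos x - cos y| <= `|x - y|.
Proof.
wlog yx : x y / y <= x.
  move=> H; have [/H//|/ltW/H] := leP y x.
  by rewrite distrC (distrC y).
have [|c _ ->] := @MVT_segment R cos (fun z => - sin z) y x yx.
  by apply/continuous_subspaceT => ?; exact: continuous_cos.
by rewrite normrM normrN ler_piMl// sin_max.
Qed.

Lemma sinB_le (x y : R) : `|sin x - sin y| <= `|x - y|.
Proof.
wlog yx : x y / y <= x.
  move=> H; have [/H//|/ltW/H] := leP y x.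
  by rewrite distrC (distrC y).
have [|c _ ->] := @MVT_segment R sin cos y x yx.
  by apply/continuous_subspaceT => ?; exact: continuous_sin.
by rewrite normrM ler_piMl// cos_max.
Qed.

(** The restriction of an affine weight times a real plane wave to a line parallel to an axis: [w],
    [t] are the values at the origin of the line and [dw], [dt] the slopes. *)
Definition affine_wave (w dw t dt s : R) : R := (w + dw * s) * cos (t + dt * s).

Lemma continuous_affine_wave (w dw t dt : R) : continuous (affine_wave w dw t dt).
Proof.
exact: (is_derive_continuous (fun x =>
  is_deriveM (is_derive_affine w dw x) (is_derive_cos_affine t dt x))).
Qed.

(** Integration by parts gains one power of the frequency [dt]. The second boundary term carries
    [dt ^- 2], but it is a difference of cosines at points [2 * c * dt] apart, which gives one power
    back; the bound is therefore of order 1 / |dt| for small [dt] as well. *)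
Lemma integral_affine_wave (w dw t dt c : R) : 0 <= c -> dt != 0 ->
  (`|\int[lebesgue_measure]_(s in `[(- c)%R, c]) (affine_wave w dw t dt s)%:E| <=
     (4 * (`|w| + `|dw| * c) / `|dt|)%R%:E)%E.
Proof.
move=> c0 dt0.
pose F s := (w + dw * s) * (dt^-1 * sin (t + dt * s)) +
            dw / dt ^+ 2 * cos (t + dt * s).
have dF (x : R) : is_derive x 1 F (affine_wave w dw t dt x).
  have dS : is_derive x 1 (fun s => dt^-1 * sin (t + dt * s))
      (dt^-1 *: (cos (t + dt * x) * dt)).
    exact: (is_deriveZ dt^-1 (is_derive_sin_affine t dt x)).
  have dC : is_derive x 1 (fun s => dw / dt ^+ 2 * cos (t + dt * s))
      ((dw / dt ^+ 2) *: (- sin (t + dt * x) * dt)).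
    exact: (is_deriveZ _ (is_derive_cos_affine t dt x)).
  apply: (is_derive_eq (is_deriveD (is_deriveM (is_derive_affine w dw x) dS) dC)).
  by rewrite /affine_wave /GRing.scale/=; field.
rewrite (integral_is_derive _ (@continuous_affine_wave _ _ _ _) dF); last by lra.
rewrite /= lee_fin.
have -> : F c - F (- c) = (w + dw * c) * sin (t + dt * c) / dt
    + - ((w - dw * c) * sin (t - dt * c) / dt)
    + dw * (cos (t + dt * c) - cos (t - dt * c)) / dt ^+ 2.
  by rewrite /F !mulrN; field.
have dt_gt0 : 0 < `|dt| by rewrite normr_gt0.
rewrite ler_pdivlMr// -normrM.
have -> : ((w + dw * c) * sin (t + dt * c) / dt
      + - ((w - dw * c) * sin (t - dt * c) / dt)
      + dw * (cos (t + dt * c) - cos (t - dt * c)) / dt ^+ 2) * dt =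
    (w + dw * c) * sin (t + dt * c) - (w - dw * c) * sin (t - dt * c)
      + dw * ((cos (t + dt * c) - cos (t - dt * c)) / dt) by field.
have B1 (u v : R) : `|u * sin v| <= `|u| by rewrite normrM ler_piMr// sin_max.
(* The Lipschitz bound, rather than the trivial bound 2 on the difference of cosines, is what avoids
   a second power of 1 / |dt|. *)
have Bc : `|(cos (t + dt * c) - cos (t - dt * c)) / dt| <= 2 * c.
  rewrite normrM normfV ler_pdivrMr//; apply: le_trans (cosB_le _ _) _.
  have -> : t + dt * c - (t - dt * c) = 2 * c * dt by ring.
  by rewrite normrM (ger0_norm (_ : 0 <= 2 * c)) ?mulr_ge0.
apply: le_trans (ler_normD _ _) _; apply: (@le_trans _ _
  (`|w + dw * c| + `|w - dw * c| + `|dw| * (2 * c))).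
  apply: lerD; last by rewrite normrM ler_wpM2l.
  by apply: le_trans (ler_normB _ _) _; apply: lerD.
have nc : `|dw * c| = `|dw| * c by rewrite normrM (ger0_norm c0).
have := ler_normD w (dw * c); have := ler_normB w (dw * c); rewrite nc.
by have : 0 <= `|w| by []; lra.
Qed.

Lemma integral_affine_sym (dw c : R) : 0 <= c ->
  (\int[lebesgue_measure]_(s in `[(- c)%R, c]) (dw * s)%:E = 0)%E.
Proof.
move=> c0.
have dF (x : R) : is_derive x 1 (fun s => dw / 2 * (s * s)) (dw * x).
  have := is_deriveZ (dw / 2) (is_deriveM (is_derive_id x 1) (is_derive_id x 1)).
  by move=> /is_derive_eq; apply; rewrite /GRing.scale/=; field.
have cf : continuous (fun x : R => dw * x).
  by apply: mulrl_continuous.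
rewrite (integral_is_derive _ cf dF) ?mulrNN ?subrr//; lra.
Qed.

End OscillatoryIntegrals.

(** * Geometry, area and slices of the disk *)

Section Disk.
Context {R : realType}.

Lemma measurable_fun_fst : measurable_fun setT (fun x : plane R => x.1 : R).
Proof. exact: measurable_fst. Qed.

Lemma measurable_fun_snd : measurable_fun setT (fun x : plane R => x.2 : R).
Proof. exact: measurable_snd. Qed.

Lemma in_disk (a : R) (x : R * R) : 0 <= a ->
  disk a x <-> x.1 ^+ 2 + x.2 ^+ 2 <= a ^+ 2.
Proof.
move=> a0; rewrite /disk/= /norm2 -[X in _ <= X <-> _](ger0_norm a0) -sqrtr_sqr.
by rewrite ler_sqrt ?sqr_ge0.
Qed.

Lemma norm2_ge (x : R * R) : `|x.1| <= norm2 x /\ `|x.2| <= norm2 x.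
Proof.
by rewrite /norm2 -!sqrtr_sqr; split; apply: ler_wsqrtr;
  rewrite ?lerDl ?lerDr sqr_ge0.
Qed.

Lemma norm2_le (x : R * R) : norm2 x <= `|x.1| + `|x.2|.
Proof.
rewrite -(@ger0_norm _ (`|x.1| + `|x.2|)) ?addr_ge0// -sqrtr_sqr.
apply: ler_wsqrtr; rewrite -(real_normK (num_real x.1)) -(real_normK (num_real x.2)).
by have := mulr_ge0 (normr_ge0 x.1) (normr_ge0 x.2); nra.
Qed.

Lemma norm2_ge0 (x : R * R) : 0 <= norm2 x.
Proof. exact: sqrtr_ge0. Qed.

Lemma measurable_disk (a : R) : 0 <= a -> @measurable _ (plane R) (disk a).
Proof.
move=> a0; rewrite (_ : disk a =
  setT `&` (fun x : plane R => x.1 ^+ 2 + x.2 ^+ 2) @^-1` `]-oo, a ^+ 2]%classic).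
  apply: measurable_funD => //; apply: measurable_funX;
    [exact: measurable_fun_fst|exact: measurable_fun_snd].
by rewrite setTI; apply/seteqP; split=> x; rewrite /= in_itv/= -(in_disk _ a0).
Qed.

Lemma lebesgue2_square (a : R) : 0 <= a ->
  lebesgue2 R (`[- a, a]%classic `*` `[- a, a]%classic) = (4 * a ^+ 2)%:E.
Proof.
move=> a0; rewrite product_measure1E//. rewrite /= !lebesgue_itvNcc// -EFinM; congr EFin.
by ring.
Qed.

Lemma lebesgue2_square_le (a : R) (A : set (plane R)) : 0 <= a ->
  @measurable _ (plane R) A ->
  (forall x, A x -> `|x.1| <= a /\ `|x.2| <= a) ->
  (lebesgue2 R A <= (4 * a ^+ 2)%:E)%E.
Proof.
move=> a0 mA sA; rewrite -lebesgue2_square//; apply: le_measure.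
- by rewrite inE.
- by rewrite inE; exact: measurableX.
- by move=> x /sA[]; rewrite !ler_norml => ? ?; split; rewrite /= in_itv.
Qed.

Lemma lebesgue2_disk (a : R) : 0 < a ->
  (lebesgue2 R (disk a) < +oo)%E /\ a ^+ 2 <= fine (lebesgue2 R (disk a)).
Proof.
move=> a0; have a0' := ltW a0; have mD := measurable_disk a0'.
have Doo : (lebesgue2 R (disk a) < +oo)%E.
  apply: le_lt_trans (lebesgue2_square_le a0' mD _) (ltry _) => x xa.
  by have [x1 x2] := norm2_ge x; split; exact: le_trans xa.
split=> //; rewrite -lee_fin fineK ?ge0_fin_numE//.
(* The inscribed square of half-side [a / 2] has area exactly [a ^+ 2]. *)
have -> : (a ^+ 2)%:E = (4 * (a / 2) ^+ 2)%:E by congr EFin; field.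
rewrite -lebesgue2_square ?divr_ge0//; apply: le_measure => //.
- by rewrite inE; exact: measurableX.
- by rewrite inE.
- move=> x [/=]; rewrite !in_itv/= => /andP[? ?] /andP[? ?].
  by rewrite in_disk//; nra.
Qed.

Lemma disk_slice (a x y : R) : 0 <= a ->
  disk a (x, y) <->
  `|x| <= a /\ y \in `[- Num.sqrt (a ^+ 2 - x ^+ 2), Num.sqrt (a ^+ 2 - x ^+ 2)].
Proof.
move=> a0; rewrite in_disk//= in_itv/= -ler_norml.
have xa : (`|x| <= a) = (0 <= a ^+ 2 - x ^+ 2).
  by rewrite subr_ge0 -(real_normK (num_real x)) ler_sqr ?nnegrE.
split=> [xy|[]]; rewrite xa.
  have a2 : 0 <= a ^+ 2 - x ^+ 2 by have := sqr_ge0 y; lra.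
  by split=> //; rewrite -sqrtr_sqr ler_sqrt//; lra.
by move=> a2; rewrite -sqrtr_sqr ler_sqrt//; lra.
Qed.

Lemma disk_swap (a x y : R) : disk a (x, y) <-> disk a (y, x).
Proof. by rewrite /disk/= /norm2/= addrC. Qed.

Lemma bounded_measurable_fst (A : set (plane R)) (M : R) :
  (forall x, A x -> `|x.1| <= M) -> bounded_measurable A (fun x => x.1).
Proof. by split; [exact: measurable_fun_fst|exists M]. Qed.

Lemma bounded_measurable_snd (A : set (plane R)) (M : R) :
  (forall x, A x -> `|x.2| <= M) -> bounded_measurable A (fun x => x.2).
Proof. by split; [exact: measurable_fun_snd|exists M]. Qed.

Lemma bounded_measurable_disk_fst (a : R) : bounded_measurable (disk a) (fun x => x.1).
Proof.
by apply: (@bounded_measurable_fst _ a) => x; apply: le_trans (norm2_ge x).1.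
Qed.

Lemma bounded_measurable_disk_snd (a : R) : bounded_measurable (disk a) (fun x => x.2).
Proof.
by apply: (@bounded_measurable_snd _ a) => x; apply: le_trans (norm2_ge x).2.
Qed.

Lemma bounded_measurable_cos (A : set (plane R)) (f : plane R -> R) :
  measurable_fun setT f -> bounded_measurable A (fun x => cos (f x)).
Proof.
move=> mf; split; last by exists 1 => x _; exact: cos_max.
by apply: measurableT_comp => //; apply: continuous_measurable_fun; exact: continuous_cos.
Qed.

Definition plane_wave (w w1 w2 t t1 t2 : R) (x : R * R) : R :=
  (w + w1 * x.1 + w2 * x.2) * cos (t + t1 * x.1 + t2 * x.2).

Lemma bounded_measurable_wave (a w w1 w2 t t1 t2 : R) :
  bounded_measurable (disk a) (plane_wave w w1 w2 t t1 t2).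
Proof.
have bmA c c1 c2 : bounded_measurable (disk a) (fun x => c + c1 * x.1 + c2 * x.2).
  apply: bounded_measurableD; last first.
    by apply: bounded_measurableM;
      [exact: bounded_measurable_cst|exact: bounded_measurable_disk_snd].
  apply: bounded_measurableD; first exact: bounded_measurable_cst.
  by apply: bounded_measurableM;
    [exact: bounded_measurable_cst|exact: bounded_measurable_disk_fst].
by apply: bounded_measurableM => //; apply: bounded_measurable_cos; exact: (bmA _ _ _).1.
Qed.

(** Removes the dependence of the one-dimensional bound on the slice, so that it can be integrated
    over all slices. *)
Lemma wave_bound (a w w1 w2 x t2 c : R) : 0 < a -> `|x| <= a -> 0 <= c -> c <= a ->
  4 * (`|w + w1 * x| + `|w2| * c) / `|t2|
    <= 4 * (`|w| + `|w1| * a + `|w2| * a) / `|t2|.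
Proof.
move=> a0 xa c0 ca; rewrite ler_wpM2r ?invr_ge0// ler_wpM2l//.
apply: lerD; last by rewrite ler_wpM2l.
by apply: le_trans (ler_normD _ _) _; rewrite lerD2l normrM ler_wpM2l.
Qed.

Lemma sqrt_slice_le (a x : R) : 0 < a -> Num.sqrt (a ^+ 2 - x ^+ 2) <= a.
Proof.
move=> a0; rewrite -[leRHS](ger0_norm (ltW a0)) -[leRHS]sqrtr_sqr.
by apply: ler_wsqrtr; have := sqr_ge0 x; lra.
Qed.

Lemma integral_disk_slice1 (f : plane R -> R) (a x : R) : 0 < a ->
  (\int[lebesgue_measure]_y ((f \_ (disk a)) (x, y))%:E =
   if (`|x| <= a)%R then
     \int[lebesgue_measure]_(y in `[(- Num.sqrt (a ^+ 2 - x ^+ 2))%R,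
       Num.sqrt (a ^+ 2 - x ^+ 2)%R]) (f (x, y))%:E
   else 0)%E.
Proof.
move=> a0; case: ifPn => [xa|xa].
  rewrite [RHS]integral_mkcond; apply: eq_integral => y _.
  rewrite !patchE; case: ifPn; rewrite ?notin_setE ?in_setE.
    by move=> /(disk_slice _ _ (ltW a0))[_ yc]; rewrite mem_set.
  by move=> D; rewrite memNset//= => yc; apply: D; apply/disk_slice => //; exact: ltW.
rewrite integral0_eq// => y _; rewrite patchE memNset//.
by move=> /(disk_slice _ _ (ltW a0))[]; rewrite (negbTE xa).
Qed.

Lemma integral_disk_slice2 (f : plane R -> R) (a y : R) : 0 < a ->
  (\int[lebesgue_measure]_x ((f \_ (disk a)) (x, y))%:E =
   if (`|y| <= a)%R then
     \int[lebesgue_measure]_(x in `[(- Num.sqrt (a ^+ 2 - y ^+ 2))%R,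
       Num.sqrt (a ^+ 2 - y ^+ 2)%R]) (f (x, y))%:E
   else 0)%E.
Proof.
move=> a0; rewrite -(integral_disk_slice1 (fun x => f (x.2, x.1)) _ a0).
apply: eq_integral => x _; rewrite !patchE/=.
case: ifPn; rewrite ?notin_setE ?in_setE => /disk_swap D; first by rewrite mem_set.
by rewrite memNset.
Qed.

End Disk.

Section DiskWaves.
Context {R : realType}.
(** Multiplying by the frequency instead of dividing covers zero frequencies. Each component of the
    frequency is controlled by slicing along its own axis, at cost 8 = 2 * 4; since the norm is at
    most the sum of the two moduli, adding both bounds replaces the choice of the larger
    component. *)
Lemma disk_wave (a w w1 w2 t t1 t2 : R) : 0 < a ->
  norm2 (t1, t2) *
    `|\int[lebesgue2 R]_(x in disk a) plane_wave w w1 w2 t t1 t2 x|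
  <= 16 * a * (`|w| + `|w1| * a + `|w2| * a).
Proof.
move=> a0; have a0' := ltW a0.
have mD := measurable_disk a0'; have [Doo _] := lebesgue2_disk a0.
set I := `| _ |; set W := `|w| + _ + _.
have W0 : 0 <= W by rewrite !addr_ge0 ?mulr_ge0.
have bf := bounded_measurable_wave a w w1 w2 t t1 t2.
have H2 : `|t2| * I <= 8 * a * W.
  have [->|t20] := eqVneq t2 0; first by rewrite normr0 mul0r !mulr_ge0.
  rewrite mulrC -ler_pdivlMr ?normr_gt0//.
  have -> : 8 * a * W / `|t2| = 2 * a * (4 * W / `|t2|) by ring.
  apply: normr_Rintegral_strip1 => // [|x].
    by rewrite divr_ge0 ?mulr_ge0.
  rewrite (integral_disk_slice1 _ _ a0) indicE mem_setE/= in_itv/= -ler_norml.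
  case: ifPn => xa; last by rewrite abse0 mulr0.
  rewrite mulr1.
  have X := integral_affine_wave (w + w1 * x) w2 (t + t1 * x)
    (sqrtr_ge0 (a ^+ 2 - x ^+ 2)) t20.
  apply: (le_trans X).
  by rewrite lee_fin; apply: wave_bound => //; exact: sqrt_slice_le.
have H1 : `|t1| * I <= 8 * a * W.
  have [->|t10] := eqVneq t1 0; first by rewrite normr0 mul0r !mulr_ge0.
  rewrite mulrC -ler_pdivlMr ?normr_gt0//.
  have -> : 8 * a * W / `|t1| = 2 * a * (4 * W / `|t1|) by ring.
  apply: normr_Rintegral_strip2 => // [|x].
    by rewrite divr_ge0 ?mulr_ge0.
  rewrite (integral_disk_slice2 _ _ a0) indicE mem_setE/= in_itv/= -ler_norml.
  case: ifPn => xa; last by rewrite abse0 mulr0.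
  rewrite mulr1.
  have := integral_affine_wave (w + w2 * x) w1 (t + t2 * x)
    (sqrtr_ge0 (a ^+ 2 - x ^+ 2)) t10.
  under eq_integral do rewrite /affine_wave addrAC [X in cos X]addrAC.
  move=> X; apply: (le_trans X).
  rewrite lee_fin /W addrAC.
  by apply: wave_bound => //; exact: sqrt_slice_le.
have := norm2_le (t1, t2); rewrite /= => /(ler_wpM2r (normr_ge0 _ : 0 <= I)).
by rewrite mulrDl; lra.
Qed.

(** Every slice is an interval symmetric about 0, so the inner integral vanishes and the strip bound
    applies with [B = 0]. *)
Lemma disk_odd (a : R) : 0 < a ->
  \int[lebesgue2 R]_(x in disk a) x.1 = 0 /\
  \int[lebesgue2 R]_(x in disk a) x.2 = 0.
Proof.
move=> a0; have a0' := ltW a0.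
have mD := measurable_disk a0'; have [Doo _] := lebesgue2_disk a0.
have bf1 := bounded_measurable_disk_fst a; have bf2 := bounded_measurable_disk_snd a.
split; apply/eqP; rewrite -normr_eq0 eq_le normr_ge0 andbT -(mulr0 (2 * a)).
  apply: normr_Rintegral_strip2 => // y; rewrite (integral_disk_slice2 _ _ a0) mul0r.
  case: ifPn => _; last by rewrite abse0.
  by have := integral_affine_sym 1 (sqrtr_ge0 (a ^+ 2 - y ^+ 2));
    under eq_integral do rewrite mul1r; move=> ->; rewrite abse0.
apply: normr_Rintegral_strip1 => // y; rewrite (integral_disk_slice1 _ _ a0) mul0r.
case: ifPn => _; last by rewrite abse0.
by have := integral_affine_sym 1 (sqrtr_ge0 (a ^+ 2 - y ^+ 2));
  under eq_integral do rewrite mul1r; move=> ->; rewrite abse0.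
Qed.

End DiskWaves.

(** * Complex-valued integrals *)

Section ComplexIntegrals.
Local Open Scope complex_scope.
Context {R : realType}.
Local Notation C := R[i].
Implicit Types (A : set (plane R)) (f g : plane R -> C).

Definition bounded_measurableC A f : Prop :=
  bounded_measurable A (fun x => complex.Re (f x)) /\
  bounded_measurable A (fun x => complex.Im (f x)).

Lemma ReM (z w : C) :
  complex.Re (z * w) = complex.Re z * complex.Re w - complex.Im z * complex.Im w.
Proof. by case: z w => [? ?] [? ?]. Qed.

Lemma ImM (z w : C) :
  complex.Im (z * w) = complex.Re z * complex.Im w + complex.Im z * complex.Re w.
Proof. by case: z w => [? ?] [? ?]. Qed.

Lemma ReD (z w : C) : complex.Re (z + w) = complex.Re z + complex.Re w.
Proof. by case: z w => [? ?] [? ?]. Qed.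

Lemma ImD (z w : C) : complex.Im (z + w) = complex.Im z + complex.Im w.
Proof. by case: z w => [? ?] [? ?]. Qed.

Lemma ReJ (z : C) : complex.Re (conjc z) = complex.Re z.
Proof. by case: z. Qed.

Lemma ImJ (z : C) : complex.Im (conjc z) = - complex.Im z.
Proof. by case: z. Qed.

Lemma bounded_measurableCD A f g : bounded_measurableC A f ->
  bounded_measurableC A g -> bounded_measurableC A (fun x => f x + g x).
Proof.
move=> [fr fi] [gr gi]; split.
  under eq_fun do rewrite ReD; exact: bounded_measurableD.
under eq_fun do rewrite ImD; exact: bounded_measurableD.
Qed.

Lemma bounded_measurableCM A f g : bounded_measurableC A f ->
  bounded_measurableC A g -> bounded_measurableC A (fun x => f x * g x).
Proof.
move=> [fr fi] [gr gi]; split.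
  by under eq_fun do rewrite ReM; apply: bounded_measurableB; exact: bounded_measurableM.
by under eq_fun do rewrite ImM; apply: bounded_measurableD; exact: bounded_measurableM.
Qed.

Lemma bounded_measurableC_cst A (c : C) : bounded_measurableC A (fun=> c).
Proof. by split; exact: bounded_measurable_cst. Qed.

Lemma bounded_measurableCB A f g : bounded_measurableC A f ->
  bounded_measurableC A g -> bounded_measurableC A (fun x => f x - g x).
Proof.
move=> bf bg; under eq_fun do rewrite -mulN1r.
apply: bounded_measurableCD => //.
by apply: bounded_measurableCM => //; exact: bounded_measurableC_cst.
Qed.

Lemma bounded_measurableC_conj A f : bounded_measurableC A f ->
  bounded_measurableC A (fun x => conjc (f x)).
Proof.
move=> [fr fi]; split.
  by under eq_fun do rewrite ReJ.
by under eq_fun do rewrite ImJ; exact: bounded_measurableN.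
Qed.

Lemma bounded_measurableC_real A (f : plane R -> R) : bounded_measurable A f ->
  bounded_measurableC A (fun x => (f x)%:C).
Proof. by move=> bf; split=> //; exact: bounded_measurable_cst. Qed.

Lemma bounded_measurableC_sum A (I : Type) (s : seq I) (f : I -> plane R -> C) :
  (forall i, bounded_measurableC A (f i)) ->
  bounded_measurableC A (fun x => \sum_(i <- s) f i x).
Proof.
move=> bf; rewrite (_ : (fun x => _) = \sum_(i <- s) f i); last first.
  by apply/funext => x; rewrite fct_sumE.
elim/big_ind : _ => [|? ? ? ?|//]; first exact: bounded_measurableC_cst.
exact: bounded_measurableCD.
Qed.

Lemma bounded_measurableC_expi A (f : plane R -> R) : measurable_fun setT f ->
  bounded_measurableC A (fun x => expi (f x)).
Proof.
move=> mf; split; first exact: bounded_measurable_cos.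
split; last by exists 1 => x _; exact: sin_max.
by apply: measurableT_comp => //; apply: continuous_measurable_fun; exact: continuous_sin.
Qed.

Lemma normc_ReIm (z : C) : `|complex.Re z| <= Normc.normc z /\
  `|complex.Im z| <= Normc.normc z.
Proof. by case: z => x y; exact: (norm2_ge (x, y)). Qed.

Lemma normc_le (z : C) : Normc.normc z <= `|complex.Re z| + `|complex.Im z|.
Proof. by case: z => x y; exact: (norm2_le (x, y)). Qed.

Section FiniteArea.
Variables (A : set (plane R)) (mA : @measurable _ (plane R) A)
  (Aoo : (lebesgue2 R A < +oo)%E).

Let intf f : bounded_measurableC A f ->
  (lebesgue2 R).-integrable A (EFin \o (fun x => complex.Re (f x))) /\
  (lebesgue2 R).-integrable A (EFin \o (fun x => complex.Im (f x))).
Proof. by case=> ? ?; split; exact: bounded_measurable_integrable. Qed.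

Lemma cintegralD f g : bounded_measurableC A f -> bounded_measurableC A g ->
  cintegral A (fun x => f x + g x) = cintegral A f + cintegral A g.
Proof.
move=> /intf[fr fi] /intf[gr gi].
apply/eqP; rewrite eq_complex ReD ImD /=; apply/andP; split; apply/eqP.
  by rewrite -RintegralD//; apply: eq_Rintegral => x _; rewrite ReD.
by rewrite -RintegralD//; apply: eq_Rintegral => x _; rewrite ImD.
Qed.

Lemma cintegralZ (c : C) f : bounded_measurableC A f ->
  cintegral A (fun x => c * f x) = c * cintegral A f.
Proof.
case: c => a b bf; have [fr fi] := bf; have [ifr ifi] := intf bf.
have bZ (r : R) (h : plane R -> R) : bounded_measurable A h ->
    (lebesgue2 R).-integrable A (EFin \o (fun x => r * h x)).
  move=> bh; apply: bounded_measurable_integrable => //.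
  by apply: bounded_measurableM => //; exact: bounded_measurable_cst.
apply/eqP; rewrite eq_complex ReM ImM /=; apply/andP; split; apply/eqP.
  by under eq_Rintegral do rewrite ReM /=; rewrite RintegralB ?RintegralZl//; exact: bZ.
by under eq_Rintegral do rewrite ImM /=; rewrite RintegralD ?RintegralZl//; exact: bZ.
Qed.

Lemma cintegral_cst (c : C) : cintegral A (fun=> c) = c * (fine (lebesgue2 R A))%:C.
Proof.
case: c => a b; rewrite /cintegral !Rintegral_cst//=.
by apply/eqP; rewrite eq_complex/= !mulr0 subr0 add0r !eqxx.
Qed.

Lemma cintegral_sum (I : Type) (s : seq I) (f : I -> plane R -> C) :
  (forall i, bounded_measurableC A (f i)) ->
  cintegral A (fun x => \sum_(i <- s) f i x) = \sum_(i <- s) cintegral A (f i).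
Proof.
move=> bf; elim: s => [|i s IH].
  rewrite big_nil; under eq_fun do rewrite big_nil.
  by rewrite cintegral_cst mul0r.
rewrite big_cons -IH; under eq_fun do rewrite big_cons.
by rewrite cintegralD//; exact: bounded_measurableC_sum.
Qed.

(** The factor 2 is the price of bounding the real and imaginary parts separately. *)
Lemma normc_cintegral_le (f : plane R -> C) (B : R) : bounded_measurableC A f ->
  (forall x, A x -> Normc.normc (f x) <= B) ->
  Normc.normc (cintegral A f) <= 2 * B * fine (lebesgue2 R A).
Proof.
move=> [[mr _] [mi _]] fB; apply: le_trans (normc_le _) _.
rewrite -mulrA mulrDl mul1r; apply: lerD.
  by apply: normr_Rintegral_le => // x Ax; apply: le_trans (normc_ReIm _).1 (fB x Ax).
by apply: normr_Rintegral_le => // x Ax; apply: le_trans (normc_ReIm _).2 (fB x Ax).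
Qed.

End FiniteArea.
End ComplexIntegrals.

(** * The Green function and the Kirchhoff image *)

Section GreenIntegrals.
Local Open Scope complex_scope.
Context {R : realType}.
Local Notation C := R[i].
Implicit Types (u : R * R) (z k : R) (x : plane R).

Definition range u z x : R :=
  Num.sqrt ((x.1 - u.1) ^+ 2 + (x.2 - u.2) ^+ 2 + z ^+ 2).

Definition offset u z x : 'I_3 -> R := nth 0 [:: x.1 - u.1; x.2 - u.2; - z].

Lemma point3B u z x i : (point3 x 0 - point3 u z) i 0 = offset u z x i.
Proof. by rewrite !mxE /offset; case: i => [[|[|[|//]]] Hi] /=; rewrite ?sub0r. Qed.

Lemma norm3_range u z x : norm3 (point3 x 0 - point3 u z) = range u z x.
Proof.
rewrite /norm3 !big_ord_recr big_ord0/= add0r !point3B /offset/= sqrrN.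
by [].
Qed.

Lemma range_ge u z x : 0 < z -> z <= range u z x.
Proof.
move=> z0; rewrite -[leLHS](ger0_norm (ltW z0)) -[leLHS]sqrtr_sqr.
by apply: ler_wsqrtr; rewrite lerDr addr_ge0 ?sqr_ge0.
Qed.

(** The bracket of the Green tensor, stripped of the spherical wave; the oscillation in [k] at fixed
    distance sits entirely in the removed factor, up to the small near-field correction. *)
Definition dyad k u z x (i j : 'I_3) : C :=
  (1 + mfactor (k * range u z x)) *+ (i == j) -
    (1 + 3 * mfactor (k * range u z x)) *
      ((range u z x ^+ 2)^-1 * (offset u z x i * offset u z x j))%:C.

Lemma dyadic_green_entry k u z x (i j : 'I_3) :
  dyadic_green k (point3 x 0) (point3 u z) i j =
  expi (k * range u z x) / (4 * pi * range u z x)%:C * dyad k u z x i j.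
Proof.
rewrite /dyadic_green /green /dyad !mxE norm3_range big_ord1.
by rewrite [(_^T)%R _ _]mxE !point3B.
Qed.

Lemma dyadic_green_sym k u z x i j :
  dyadic_green k (point3 x 0) (point3 u z) i j =
  dyadic_green k (point3 x 0) (point3 u z) j i.
Proof. by rewrite !dyadic_green_entry /dyad eq_sym (mulrC (offset _ _ _ i)). Qed.

Lemma norm3N (v : 'cV[R]_3) : norm3 (- v) = norm3 v.
Proof. by rewrite /norm3; under eq_bigr do rewrite mxE sqrrN. Qed.

Lemma dyadic_greenC k (v w : 'cV[R]_3) : dyadic_green k v w = dyadic_green k w v.
Proof.
rewrite /dyadic_green /green -opprB norm3N; congr (_ *: (_ - _ *: map_mx _ (_ *: _))).
by rewrite linearN mulNmx mulmxN opprK.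
Qed.

Lemma measurable_range u z : measurable_fun setT (range u z).
Proof.
apply: measurableT_comp; first by apply: continuous_measurable_fun; exact: sqrt_continuous.
have mB (f : plane R -> R) c : measurable_fun setT f ->
    measurable_fun setT (fun x => (f x - c) ^+ 2).
  by move=> mf; apply: measurable_funX; exact: measurable_funB.
apply: measurable_funD; last exact: measurable_cst.
by apply: measurable_funD; apply: mB; [exact: measurable_fun_fst|exact: measurable_fun_snd].
Qed.

Lemma measurable_inv : measurable_fun [set: R] (fun x : R => x^-1).
Proof.
(* Reduces to the measurability of real powers: squaring makes the base nonnegative, and the factor
   [t] gives the right value 0 at the origin. *)
have -> : (fun x : R => x^-1) = (fun t => t * (t ^+ 2) `^ (- 1)).
  apply/funext => t; rewrite powR_inv1 ?sqr_ge0//.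
  by have [->|t0] := eqVneq t 0; [rewrite invr0 mul0r|field].
apply: measurable_funM => //; apply: (measurableT_comp (measurable_powR (- 1))).
exact: measurable_funX.
Qed.

Variables (A : set (plane R)) (M : R).
Hypothesis AM : forall x, A x -> `|x.1| <= M /\ `|x.2| <= M.

Lemma bounded_measurable_offset u z i : bounded_measurable A (fun x => offset u z x i).
Proof.
rewrite /offset; case: i => [[|[|[|//]]] Hi] /=; last exact: bounded_measurable_cst.
- apply: bounded_measurableB; last exact: bounded_measurable_cst.
  by apply: (@bounded_measurable_fst _ _ M) => x /AM[].
- apply: bounded_measurableB; last exact: bounded_measurable_cst.
  by apply: (@bounded_measurable_snd _ _ M) => x /AM[].
Qed.

Lemma bounded_measurable_range u z : bounded_measurable A (range u z).
Proof.
split; first exact: measurable_range.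
exists (M + `|u.1| + (M + `|u.2|) + `|z|) => x /AM[x1 x2].
have le3 (a b c : R) : Num.sqrt (a ^+ 2 + b ^+ 2 + c ^+ 2) <= `|a| + `|b| + `|c|.
  have := norm2_le (Num.sqrt (a ^+ 2 + b ^+ 2), c).
  rewrite /norm2/= sqr_sqrtr ?addr_ge0 ?sqr_ge0// ger0_norm ?sqrtr_ge0// => /le_trans; apply.
  by rewrite lerD2r; exact: (norm2_le (a, b)).
rewrite ger0_norm ?sqrtr_ge0//; apply: le_trans (le3 _ _ _) _.
rewrite lerD2r; apply: lerD; apply: le_trans (ler_normB _ _) _; exact: lerD.
Qed.

Lemma bounded_measurable_inv_range u z : 0 < z ->
  bounded_measurable A (fun x => (range u z x)^-1).
Proof.
move=> z0; split.
  exact: (measurableT_comp measurable_inv (measurable_range u z)).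
exists z^-1 => x _; have zr := range_ge u x z0.
have r0 := lt_le_trans z0 zr.
by rewrite normfV ger0_norm ?(ltW r0)// lef_pV2 ?posrE.
Qed.

Lemma bounded_measurableC_green k u z (i j : 'I_3) : 0 < z ->
  bounded_measurableC A (fun x => dyadic_green k (point3 x 0) (point3 u z) i j).
Proof.
move=> z0; have bi := bounded_measurable_inv_range u z0.
have br := bounded_measurable_range u z.
have bc (c : R) : bounded_measurable A (fun=> c) by exact: bounded_measurable_cst.
have bcC (c : C) : bounded_measurableC A (fun=> c) by exact: bounded_measurableC_cst.
have bm : bounded_measurableC A (fun x => mfactor (k * range u z x)).
  rewrite /mfactor; under eq_fun do
    rewrite -fmorphV/= exprMn invfM -[(range _ _ _ ^+ 2)^-1]exprVn.
  apply: bounded_measurableCM.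
    by split=> /=; [exact: bc|exact: bounded_measurableM].
  by apply: bounded_measurableC_real; apply: bounded_measurableM => //;
    apply: bounded_measurableM.
under eq_fun do
  rewrite dyadic_green_entry /dyad -fmorphV/= invfM -[(range _ _ _ ^+ 2)^-1]exprVn.
have bD : bounded_measurableC A
    (fun x => (1 + mfactor (k * range u z x)) *+ (i == j)).
  by case: eqP => _; [exact: bounded_measurableCD|exact: bcC].
apply: bounded_measurableCM.
  apply: bounded_measurableCM.
    by apply: bounded_measurableC_expi; exact: (bounded_measurableM (bc k) br).1.
  by apply: bounded_measurableC_real; exact: bounded_measurableM.
apply: bounded_measurableCB => //; apply: bounded_measurableCM.
  by apply: bounded_measurableCD => //; exact: bounded_measurableCM.
apply: bounded_measurableC_real; apply: bounded_measurableM.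
  exact: bounded_measurableM.
by apply: bounded_measurableM; exact: bounded_measurable_offset.
Qed.

Lemma bounded_measurableC_green2 k u z v w (i j : 'I_3) : 0 < z -> 0 < w ->
  bounded_measurableC A (fun x =>
   (conj_mx (dyadic_green k (point3 x 0) (point3 u z))
      *m dyadic_green k (point3 x 0) (point3 v w)) i j).
Proof.
move=> z0 w0; under eq_fun do rewrite mxE.
apply: bounded_measurableC_sum => l; apply: bounded_measurableCM.
  under eq_fun do rewrite mxE.
  by apply: bounded_measurableC_conj; exact: bounded_measurableC_green.
exact: bounded_measurableC_green.
Qed.

Hypotheses (mA : @measurable _ (plane R) A) (Aoo : (lebesgue2 R A < +oo)%E).

(** Entrywise, the integrand is a finite sum of products of a function of the receiver by a function
    of the source, so the double integral factors by linearity alone. The source factor becomes the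
    transpose of H because the Green tensor is a symmetric matrix and is symmetric in its two
    points. *)
Lemma kirchhoff_imageE N k (us : 'I_N -> R * R) (zs : 'I_N -> R)
    (alpha : 'I_N -> 'M[C]_3) v w : (forall n, 0 < zs n) -> 0 < w ->
  kirchhoff_image A k (fun n => point3 (us n) (zs n)) alpha (point3 v w) =
  \sum_n Hmx A k (point3 v w) (point3 (us n) (zs n)) *m alpha n
     *m (Hmx A k (point3 v w) (point3 (us n) (zs n)))^T.
Proof.
move=> zs0 w0.
pose m n x := conj_mx (dyadic_green k (point3 x 0) (point3 v w))
  *m dyadic_green k (point3 x 0) (point3 (us n) (zs n)).
have bm n i j : bounded_measurableC A (fun x => m n x i j).
  exact: bounded_measurableC_green2.
have gT u z x : (dyadic_green k (point3 x 0) (point3 u z))^T =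
    dyadic_green k (point3 x 0) (point3 u z).
  by apply/matrixP => i j; rewrite mxE dyadic_green_sym.
(* Reciprocity: the factors of the integrand that depend on the source are those of the receiver,
   transposed. *)
have mT n x : (m n x)^T = dyadic_green k (point3 (us n) (zs n)) (point3 x 0)
    *m conj_mx (dyadic_green k (point3 x 0) (point3 v w)).
  rewrite trmx_mul gT dyadic_greenC; congr (_ *m _); apply/matrixP => i j.
  by rewrite [LHS]mxE [LHS]mxE [RHS]mxE dyadic_green_sym.
have E x x' i j : (conj_mx (dyadic_green k (point3 x 0) (point3 v w))
      *m born_data k (fun n => point3 (us n) (zs n)) alpha x x'
      *m conj_mx (dyadic_green k (point3 x' 0) (point3 v w))) i j =
    \sum_n \sum_p (m n x *m alpha n) i p * m n x' j p.
  rewrite /born_data mulmx_sumr mulmx_suml summxE; apply: eq_bigr => n _.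
  set G := dyadic_green k (point3 x 0) (point3 (us n) (zs n)).
  have -> (P Q S : 'M[C]_3) : P *m (G *m alpha n *m Q) *m S =
      P *m G *m alpha n *m (Q *m S) by rewrite !mulmxA.
  by rewrite -mT [LHS]mxE; apply: eq_bigr => p _; rewrite [X in _ * X]mxE.
apply/matrixP => i j; rewrite /kirchhoff_image /mxintegral mxE.
have bma n p : bounded_measurableC A (fun x => (m n x *m alpha n) i p).
  under eq_fun do rewrite mxE; apply: bounded_measurableC_sum => q.
  by apply: bounded_measurableCM => //; exact: bounded_measurableC_cst.
have -> : (fun x => (\matrix_(i0, j0) cintegral A (fun x' =>
     (conj_mx (dyadic_green k (point3 x 0) (point3 v w))
      *m born_data k (fun n => point3 (us n) (zs n)) alpha x x'
      *m conj_mx (dyadic_green k (point3 x' 0) (point3 v w))) i0 j0)) i j) =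
   (fun x => \sum_n \sum_p cintegral A (fun x' => m n x' j p) * (m n x *m alpha n) i p).
  apply/funext => x; rewrite mxE; under eq_fun do rewrite E.
  rewrite cintegral_sum//; last first.
    move=> n; apply: bounded_measurableC_sum => p.
    by apply: bounded_measurableCM => //; exact: bounded_measurableC_cst.
  apply: eq_bigr => n _; rewrite cintegral_sum//; last first.
    by move=> p; apply: bounded_measurableCM => //; exact: bounded_measurableC_cst.
  by apply: eq_bigr => p _; rewrite cintegralZ// mulrC.
rewrite cintegral_sum//; last first.
  move=> n; apply: bounded_measurableC_sum => p.
  by apply: bounded_measurableCM => //; exact: bounded_measurableC_cst.
rewrite summxE; apply: eq_bigr => n _; rewrite cintegral_sum//; last first.
  by move=> p; apply: bounded_measurableCM => //; exact: bounded_measurableC_cst.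
rewrite [RHS]mxE; apply: eq_bigr => p _.
rewrite cintegralZ// mulrC; congr (_ * _); last by rewrite !mxE.
under eq_fun do rewrite mxE.
rewrite cintegral_sum//; last first.
  by move=> q; apply: bounded_measurableCM => //; exact: bounded_measurableC_cst.
rewrite [RHS]mxE; apply: eq_bigr => q _; under eq_fun do rewrite mulrC.
by rewrite cintegralZ// mulrC /Hmx mxE.
Qed.

End GreenIntegrals.

(** * Far-field expansion of the Green function *)

Section Pointwise.
Local Open Scope complex_scope.
Context {R : realType}.
Local Notation C := R[i].
Local Notation normc := Normc.normc.

Lemma normr_sqr_le (x c : R) : `|x| <= c -> x ^+ 2 <= c ^+ 2.
Proof.
move=> xc; rewrite -(real_normK (num_real x)) ler_sqr ?nnegrE//.
exact: le_trans xc.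
Qed.

Lemma normc_real (x : R) : normc x%:C = `|x|.
Proof. by rewrite /= expr0n/= addr0 sqrtr_sqr. Qed.

Lemma normcJ (z : C) : normc (conjc z) = normc z.
Proof. by case: z => x y; rewrite /= sqrrN. Qed.

Lemma normc_expi (t : R) : normc (expi t) = 1.
Proof. by rewrite /= cos2Dsin2 sqrtr1. Qed.

Lemma normc_ge0 (z : C) : 0 <= normc z.
Proof. by case: z => x y; exact: sqrtr_ge0. Qed.

Lemma normcB_le (z w : C) : normc (z - w) <= normc z + normc w.
Proof. by apply: le_trans (le_normcD _ _) _; rewrite normcN. Qed.

(** The remainder [d * e] is kept here; once both errors are multiples of [E] it is absorbed through
    E <= 1/1000. *)
Lemma normcM_close (z z0 w w0 : C) (d e : R) :
  normc (z - z0) <= d -> normc (w - w0) <= e -> normc z0 <= 1 -> normc w0 <= 1 ->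
  normc (z * w - z0 * w0) <= d + e + d * e.
Proof.
move=> zd we z1 w1.
have -> : z * w - z0 * w0 = (z - z0) * w0 + z0 * (w - w0) + (z - z0) * (w - w0) by ring.
apply: le_trans (le_normcD _ _) _; apply: lerD.
  apply: le_trans (le_normcD _ _) _; rewrite !Normc.normcM; apply: lerD.
    by rewrite -[d]mulr1; apply: ler_pM => //; exact: normc_ge0.
  by rewrite -[e]mul1r; apply: ler_pM => //; exact: normc_ge0.
by rewrite Normc.normcM; apply: ler_pM => //; exact: normc_ge0.
Qed.

Lemma expiB_le (t s : R) : normc (expi t - expi s) <= 2 * `|t - s|.
Proof.
apply: le_trans (normc_le _) _; have := cosB_le t s; have := sinB_le t s.
by rewrite /=; lra.
Qed.

Lemma conjc_expiM (t s : R) : conjc (expi t) * expi s = expi (s - t).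
Proof.
rewrite /expi cosB sinB; apply/eqP; rewrite eq_complex/=.
by apply/andP; split; apply/eqP; ring.
Qed.

Lemma normc_mfactor (s : R) : 1 <= s -> normc (mfactor s) <= 2 / s.
Proof.
move=> s1; have s0 : 0 < s by lra.
rewrite /mfactor Normc.normcM Normc.normcV normc_real ger0_norm ?sqr_ge0//.
apply: (@le_trans _ _ ((1 + s) / s ^+ 2)).
  rewrite ler_wpM2r ?invr_ge0 ?sqr_ge0//; apply: le_trans (normc_le _) _ => /=.
  by rewrite normrN1 (ger0_norm (ltW s0)).
by rewrite ler_pdivrMr ?exprn_gt0// expr2 mulrA divfK ?gt_eqF//; lra.
Qed.

(* Lengths in units of [L]: [Q] is [k L], [A], [B], [H] bound the array, the
   cross-range window and the range window, [E] is the total relative error. *)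
Definition far_regime (Q A B H E : R) : Prop :=
  [/\ [/\ 0 <= A, 0 <= B & 0 <= H],
      [/\ A ^+ 2 <= E, B <= E, H <= E, 1 <= Q * E & E <= 1 / 1000]
    & [/\ Q * B ^+ 2 <= E, Q * A ^+ 4 <= E, Q * (H * A ^+ 2) <= E
        & Q * (H * B ^+ 2) <= E]].

Definition in_box (A B H : R) (X Y : R * R) (Z : R) : Prop :=
  [/\ `|X.1| <= A /\ `|X.2| <= A, `|Y.1| <= B /\ `|Y.2| <= B & `|Z - 1| <= H].

Lemma far_E0 (Q A B H E : R) : far_regime Q A B H E -> 0 <= E.
Proof.
move=> far. by case: far => [[? ? ?] [? ? ? ? ?] _]; lra. Qed.

Lemma far_Q0 (Q A B H E : R) : far_regime Q A B H E -> 0 < Q.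
Proof.
move=> far; have E0 := far_E0 far.
case: far => _ [_ _ _ QE _] _; rewrite ltNge; apply/negP => Q0.
by have := mulr_le0_ge0 Q0 E0; lra.
Qed.

Lemma far_lt (Q A B H E : R) : far_regime Q A B H E ->
  [/\ A <= 1 / 10, B <= 1 / 1000, H <= 1 / 1000 & B ^+ 2 <= E].
Proof.
move=> far; have E0 := far_E0 far; have Q0 := far_Q0 far.
case: far => [[A0 B0 H0] [AE BE HE _ E1] _]; split; [|lra|lra|].
  by rewrite leNgt; apply/negP => ?; have : A * A > 1 / 10 * (1 / 10); nra.
by have : B * B <= B * 1 by [apply: ler_wpM2l => //; lra]; lra.
Qed.

Lemma normr_sub_le2 (a b a' b' c : R) : 0 <= a <= c -> 0 <= b <= c ->
  0 <= a' <= c -> 0 <= b' <= c -> `|a' + b' - (a + b)| <= 2 * c.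
Proof.
by rewrite ler_norml => /andP[? ?] /andP[? ?] /andP[? ?] /andP[? ?]; apply/andP; split; lra.
Qed.

Lemma normr_near1B (x y h : R) : `|x - 1| <= h -> `|y - 1| <= h ->
  `|y - x| <= 2 * h.
Proof. by rewrite !ler_norml => /andP[? ?] /andP[? ?]; apply/andP; split; lra. Qed.

(** Everything follows from r - Z = (r^2 - Z^2) / (r + Z) with r + Z >= 9/5. As A^2, B^2 and H are
    at most E, |r - 1| <= 3 (E + E) + E, and dividing by r >= 9/10 turns 7 into at most 8. *)
Lemma range_far (Q A B H E : R) (far : far_regime Q A B H E) X Y Z : in_box A B H X Y Z ->
  [/\ 9 / 10 <= Z, Z <= range Y Z X, range Y Z X - Z <= 3 * (A ^+ 2 + B ^+ 2),
      `|range Y Z X - 1| <= 7 * E & `|(range Y Z X)^-1 - 1| <= 8 * E].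
Proof.
have E0 := far_E0 far; have Q0 := far_Q0 far.
have [_ _ H1 B2E] := far_lt far.
case: far => [_ [AE BE HE _ E1] _].
move=> [[X1 X2] [Y1 Y2] ZH].
have Z9 : 9 / 10 <= Z by clear -ZH H1; move: ZH; rewrite ler_norml => /andP[]; lra.
have Z0 : 0 < Z by clear -Z9; lra.
have Zr : Z <= range Y Z X by exact: range_ge.
have sB (x y : R) : `|x| <= A -> `|y| <= B -> (x - y) ^+ 2 <= 2 * (A ^+ 2 + B ^+ 2).
  by clear; move=> /normr_sqr_le xA /normr_sqr_le yB; have := sqr_ge0 (x + y); lra.
set r := range Y Z X in Zr *.
have r2 : r ^+ 2 = (X.1 - Y.1) ^+ 2 + (X.2 - Y.2) ^+ 2 + Z ^+ 2.
  by rewrite sqr_sqrtr// !addr_ge0 ?sqr_ge0.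
have r0 : 0 < r := lt_le_trans Z0 Zr.
have A2 := sqr_ge0 A; have B2 := sqr_ge0 B.
have rZ : r - Z <= 3 * (A ^+ 2 + B ^+ 2).
  have h1 := sB _ _ X1 Y1; have h2 := sB _ _ X2 Y2.
  have h : (r - Z) * (r + Z) <= 4 * (A ^+ 2 + B ^+ 2).
    have -> : (r - Z) * (r + Z) = r ^+ 2 - Z ^+ 2 by ring.
    by rewrite r2; clear -h1 h2; lra.
  have : (r - Z) * (9 / 5) <= (r - Z) * (r + Z).
    by apply: ler_wpM2l; clear -Zr Z9; lra.
  by clear -h A2 B2; lra.
have r1 : `|r - 1| <= 7 * E.
  clear -ZH Zr rZ AE HE B2E E0.
  by move: ZH; rewrite !ler_norml => /andP[? ?]; apply/andP; split; lra.
split=> //.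
have -> : r^-1 - 1 = (1 - r) / r by field; rewrite gt_eqF.
rewrite normrM normfV (gtr0_norm r0) ler_pdivrMr// distrC; apply: le_trans r1 _.
have : E * (9 / 10) <= E * r by apply: ler_wpM2l => //; clear -Zr Z9; lra.
by clear -E0; lra.
Qed.

(** The regime bounds no product A B directly; the arithmetic-geometric inequality reduces such
    terms to those it does bound, for instance A B (A^2 + B^2) <= A^4 + B^4 <= A^4 + B^2. *)
Lemma far_mixed_terms (Q A B H E : R) (far : far_regime Q A B H E) :
  [/\ 0 <= A * B, A * B <= (A ^+ 2 + B ^+ 2) / 2,
  Q * (A * B * (A ^+ 2 + B ^+ 2)) <= 2 * E & Q * (A * B * H) <= E].
Proof.
have E0 := far_E0 far; have Q0 := far_Q0 far; have [A1 B1 _ _] := far_lt far.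
case: far => [[A0 B0 H0] _ [QB QA QHA QHB]].
have A2 := sqr_ge0 A; have B2 := sqr_ge0 B.
have AB0 : 0 <= A * B by exact: mulr_ge0.
have AB : A * B <= (A ^+ 2 + B ^+ 2) / 2 by clear; have := sqr_ge0 (A - B); lra.
split=> //.
- have e1 : (A * B) * (A ^+ 2 + B ^+ 2) <= A ^+ 4 + B ^+ 2.
    apply: (@le_trans _ _ ((A ^+ 2 + B ^+ 2) / 2 * (A ^+ 2 + B ^+ 2))).
      by apply: ler_wpM2r => //; rewrite addr_ge0.
    have h : B ^+ 2 * B ^+ 2 <= B ^+ 2 * 1.
      by apply: ler_wpM2l => //; rewrite expr_le1//; clear -B1; lra.
    have -> : A ^+ 4 = A ^+ 2 * A ^+ 2 by ring.
    move: h (sqr_ge0 (A ^+ 2 - B ^+ 2)); clear; lra.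
  by have := ler_wpM2l (ltW Q0) e1; clear -QA QB; rewrite [X in _ <= X -> _]mulrDr; lra.
- have e2 : (A * B) * H <= (H * A ^+ 2 + H * B ^+ 2) / 2.
    by have := ler_wpM2r H0 AB; clear; lra.
  by have := ler_wpM2l (ltW Q0) e2; clear -QHA QHB; lra.
Qed.

Lemma phase_far (Q A B H E : R) (far : far_regime Q A B H E) X Y Y' Z Z' :
  in_box A B H X Y Z -> in_box A B H X Y' Z' ->
  `|Q * (range Y' Z' X - range Y Z X) -
    (Q * (Z' - Z) - Q * (X.1 * (Y'.1 - Y.1) + X.2 * (Y'.2 - Y.2)))| <= 100 * E.
Proof.
have E0 := far_E0 far; have Q0 := far_Q0 far.
have [AB0 AB Qm1 Qm2] := far_mixed_terms far.
move=> b b'; have [Z9 Zr rZ _ _] := range_far far b.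
have [Z9' Zr' rZ' _ _] := range_far far b'.
case: far => [[A0 B0 H0] _ [QB _ QHA QHB]].
case: b => [[X1 X2] [Y1 Y2] ZH]; case: b' => [_ [Y1' Y2'] ZH'].
have r2 : range Y Z X ^+ 2 = (X.1 - Y.1) ^+ 2 + (X.2 - Y.2) ^+ 2 + Z ^+ 2.
  by rewrite sqr_sqrtr// !addr_ge0 ?sqr_ge0.
have r2' : range Y' Z' X ^+ 2 = (X.1 - Y'.1) ^+ 2 + (X.2 - Y'.2) ^+ 2 + Z' ^+ 2.
  by rewrite sqr_sqrtr// !addr_ge0 ?sqr_ge0.
set r := range Y Z X in Zr rZ r2 *; set r' := range Y' Z' X in Zr' rZ' r2' *.
have rr9 : 9 / 5 <= r + r' by clear -Z9 Z9' Zr Zr'; lra.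
have rr0 : 0 < r + r' by clear -rr9; lra.
pose c := X.1 * (Y'.1 - Y.1) + X.2 * (Y'.2 - Y.2).
pose q := Y'.1 ^+ 2 + Y'.2 ^+ 2 - (Y.1 ^+ 2 + Y.2 ^+ 2).
(* Exact, from r'^2 - r^2 = (Z' - Z)(Z' + Z) + q - 2 c. The three remainders are the curvature of
   the phase over the window, the cross-range phase times the deviation of r + r' from 2, and the
   range offset times the excess of the distances over the ranges. Each is controlled by its own
   phase bounds of the regime. *)
have -> : Q * (r' - r) - (Q * (Z' - Z) - Q * c) =
    (Q * q + Q * c * (r + r' - 2) - Q * (Z' - Z) * ((r - Z) + (r' - Z'))) / (r + r').
  have -> : Q * (r' - r) = Q * (r' ^+ 2 - r ^+ 2) / (r + r') by field; rewrite gt_eqF.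
  by rewrite r2 r2' /q /c; field; rewrite gt_eqF.
rewrite normrM normfV (gtr0_norm rr0) ler_pdivrMr//.
have A2 := sqr_ge0 A; have B2 := sqr_ge0 B.
have Qq : `|Q * q| <= 2 * E.
  rewrite normrM (gtr0_norm Q0).
  apply: (@le_trans _ _ (Q * (2 * B ^+ 2))); last by clear -QB; lra.
  apply: ler_wpM2l; first exact: ltW.
  by apply: normr_sub_le2; rewrite sqr_ge0 normr_sqr_le.
have cAB : `|c| <= 4 * (A * B).
  have pAB (x y y' : R) : `|x| <= A -> `|y| <= B -> `|y'| <= B ->
      `|x * (y' - y)| <= 2 * (A * B).
    move=> xA yB yB'; rewrite normrM.
    have -> : 2 * (A * B) = A * (B + B) by ring.
    by apply: ler_pM => //; apply: le_trans (ler_normB _ _) _; exact: lerD.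
  have -> : 4 * (A * B) = 2 * (A * B) + 2 * (A * B) by ring.
  by apply: le_trans (ler_normD _ _) _; apply: lerD; exact: pAB.
have rr2 : `|r + r' - 2| <= 6 * (A ^+ 2 + B ^+ 2) + 2 * H.
  clear -ZH ZH' rZ rZ' Zr Zr' A2 B2 H0.
  by move: ZH ZH'; rewrite !ler_norml => /andP[? ?] /andP[? ?]; apply/andP; split; lra.
have Qc : `|Q * c * (r + r' - 2)| <= 70 * E.
  rewrite -mulrA normrM (gtr0_norm Q0) normrM.
  apply: (@le_trans _ _ (Q * (4 * (A * B) * (6 * (A ^+ 2 + B ^+ 2) + 2 * H)))).
    by apply: ler_wpM2l; [exact: ltW|apply: ler_pM].
  have -> : Q * (4 * (A * B) * (6 * (A ^+ 2 + B ^+ 2) + 2 * H)) =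
    24 * (Q * (A * B * (A ^+ 2 + B ^+ 2))) + 8 * (Q * (A * B * H)) by ring.
  by clear -Qm1 Qm2 E0; lra.
have Qz : `|Q * (Z' - Z) * ((r - Z) + (r' - Z'))| <= 24 * E.
  rewrite -mulrA normrM (gtr0_norm Q0) normrM.
  apply: (@le_trans _ _ (Q * (2 * H * (6 * (A ^+ 2 + B ^+ 2))))).
    apply: ler_wpM2l; first exact: ltW.
    apply: ler_pM => //; first exact: normr_near1B.
    by clear -rZ rZ' Zr Zr'; rewrite ger0_norm; lra.
  by clear -QHA QHB; lra.
(* 96 = 2 + 70 + 24, and division by r + r' >= 9/5 leaves ample room below 100. *)
apply: (@le_trans _ _ (96 * E)).
  apply: le_trans (ler_normB _ _) _.
  by apply: le_trans (lerD (ler_normD _ _) (lexx _)) _; clear -Qq Qc Qz; lra.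
have : E * (9 / 5) <= E * (r + r') by exact: ler_wpM2l.
by clear -E0; lra.
Qed.

End Pointwise.

(** * The kernel of H: product of two Green tensors *)

Section Kernel.
Local Open Scope complex_scope.
Context {R : realType}.
Local Notation C := R[i].
Local Notation normc := Normc.normc.
Implicit Types (Q A B H E : R).

(** First-order part in [X] of I - v v^T with v = (X.1, X.2, -1), that is, of the projection
    transverse to the direction of propagation. The linear entries are kept because they are of size
    a / L, which is not O(E); the discarded quadratic ones are. *)
Definition far_dyad (X : R * R) (i j : nat) : R :=
  nth 0 (nth [::] [:: [:: 1; 0; X.1]; [:: 0; 1; X.2]; [:: X.1; X.2; 0]] i) j.

Lemma normr_ratio_close (o r v d e : R) : 9 / 10 <= r -> `|v| <= 1 ->
  `|r - 1| <= d -> `|o - v| <= e -> `|o / r - v| <= 10 / 9 * (d + e).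
Proof.
move=> r9 v1 rd oe; have r0 : 0 < r by lra.
have -> : o / r - v = ((o - v) + v * (1 - r)) / r by field; rewrite gt_eqF.
rewrite normrM normfV (gtr0_norm r0) ler_pdivrMr//.
apply: le_trans (ler_normD _ _) _; rewrite normrM (distrC 1).
have h1 : `|v| * `|r - 1| <= 1 * d by exact: ler_pM.
have h2 : 10 / 9 * (d + e) * (9 / 10) <= 10 / 9 * (d + e) * r.
  apply: ler_wpM2l => //; rewrite mulr_ge0//.
  have := normr_ge0 (r - 1); have := normr_ge0 (o - v); clear -rd oe; lra.
clear -h1 h2 oe; lra.
Qed.

Lemma direction_far Q A B H E (far : far_regime Q A B H E) X Y Z (i : 'I_3) :
  in_box A B H X Y Z ->
  `|offset Y Z X i / range Y Z X - nth 0 [:: X.1; X.2; - 1] i| <= 10 * E.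
Proof.
move=> b; have E0 := far_E0 far; have [A1 _ _ _] := far_lt far.
have [Z9 Zr _ r1 _] := range_far far b.
case: far b => [_ [_ BE HE _ _] _] [[X1 X2] [Y1 Y2] ZH].
have r9 := le_trans Z9 Zr; have A1' : A <= 1 by clear -A1; lra.
apply: (@le_trans _ _ (10 / 9 * (7 * E + E))); last by clear -E0; lra.
apply: normr_ratio_close => //; rewrite /offset; case: i => [[|[|[|//]]] Hi] /=.
- exact: le_trans A1'.
- exact: le_trans A1'.
- by rewrite normrN1.
- by rewrite addrAC subrr sub0r normrN; exact: le_trans BE.
- by rewrite addrAC subrr sub0r normrN; exact: le_trans BE.
- by rewrite opprK addrC distrC; exact: le_trans HE.
Qed.

Lemma normrM_close (x y x0 y0 d e : R) : `|x - x0| <= d -> `|y - y0| <= e ->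
  `|x0| <= 1 -> `|y0| <= 1 -> `|x * y - x0 * y0| <= d + e + d * e.
Proof.
move=> xd ye x1 y1; have := @normcM_close _ x%:C x0%:C y%:C y0%:C d e.
by rewrite -!rmorphM -!rmorphB !normc_real; apply.
Qed.

(** The near-field correction is O(1 / (kL)), hence O(E) by the hypothesis 1 <= Q E of the regime; 3
    leaves room for the factor 2 / r with r >= 9/10. *)
Lemma mfactor_far Q A B H E (far : far_regime Q A B H E) r : 9 / 10 <= r ->
  normc (mfactor (Q * r)) <= 3 * E.
Proof.
move=> r9; have E0 := far_E0 far; have Q0 := far_Q0 far.
case: far => [_ [_ _ _ QE E1] _].
have QEr : Q * E * (9 / 10) <= Q * E * r by apply: ler_wpM2l => //; rewrite mulr_ge0// ltW.
have r0 : 0 < r by clear -r9; lra.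
(* From 1 <= Q E and E <= 1/1000 the wavenumber [Q] is at least 1000. *)
have Qr1 : 1 <= Q * r.
  have h : Q * E <= Q * (1 / 1000) by apply: ler_wpM2l => //; exact: ltW.
  have h' : Q * (9 / 10) <= Q * r by apply: ler_wpM2l => //; exact: ltW.
  by clear -h h' QE; lra.
apply: le_trans (normc_mfactor Qr1) _.
by rewrite ler_pdivrMr ?mulr_gt0//; clear -QEr QE; lra.
Qed.

Lemma far_dyad_close A E (X : R * R) (i j : 'I_3) : 0 <= E -> A ^+ 2 <= E ->
  `|X.1| <= A -> `|X.2| <= A ->
  `|(i == j)%:R - nth 0 [:: X.1; X.2; - 1] i * nth 0 [:: X.1; X.2; - 1] j
    - far_dyad X i j| <= E.
Proof.
move=> E0 AE X1 X2; have XX (x y : R) : `|x| <= A -> `|y| <= A -> `|x * y| <= E.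
  by move=> xA yA; rewrite normrM; apply: le_trans AE; rewrite expr2 ler_pM.
by case: i => [[|[|[|//]]] Hi]; case: j => [[|[|[|//]]] Hj]; rewrite /far_dyad/=
  ?mulrN1 ?mulN1r ?mul0r ?opprK ?sub0r ?add0r ?subr0 ?subrr ?normr0 ?normrN //;
  rewrite ?[1 - _ - 1]addrAC ?subrr ?sub0r ?normrN ?normr0//; exact: XX.
Qed.

Lemma dyad_far Q A B H E (far : far_regime Q A B H E) X Y Z (i j : 'I_3) :
  in_box A B H X Y Z ->
  normc (dyad Q Y Z X i j - (far_dyad X i j)%:C) <= 50 * E.
Proof.
rewrite /dyad; set m := mfactor _.
move=> b; have E0 := far_E0 far; have [A1 _ _ _] := far_lt far.
have [Z9 Zr _ _ _] := range_far far b.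
have mE : normc m <= 3 * E by apply: (mfactor_far far); exact: le_trans Zr.
have di := direction_far far i b; have dj := direction_far far j b.
case: far b => [_ [AE _ _ _ E1] _] [[X1 X2] _ _].
have v1 (l : 'I_3) : `|nth 0 [:: X.1; X.2; - 1] l| <= 1.
  have A1' : A <= 1 by clear -A1; lra.
  by case: l => [[|[|[|//]]] Hi] /=; rewrite ?normrN1//; exact: le_trans A1'.
have vv := normrM_close di dj (v1 i) (v1 j).
have fd := far_dyad_close i j E0 AE X1 X2.
have -> : (range Y Z X ^+ 2)^-1 * (offset Y Z X i * offset Y Z X j) =
    (offset Y Z X i / range Y Z X) * (offset Y Z X j / range Y Z X).
  by rewrite -exprVn; ring.
set w := offset Y Z X i / _ * _ in vv *.
set v := nth 0 _ i * nth 0 _ j in vv fd.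
have vE : `|v| <= 1 by rewrite normrM mulr_ile1.
have EE : E * E <= E * (1 / 1000) by exact: ler_wpM2l.
have wE : `|w - v| <= 21 * E by apply: le_trans vv _; clear -EE E0; lra.
have w2 : `|w| <= 2.
  have -> : w = (w - v) + v by ring.
  by apply: le_trans (ler_normD _ _) _; clear -wE vE E1; lra.
(* Separates the real projection part from the near-field part, which is linear in [m]; they
   contribute 22 E and 3 E + 18 E. *)
have -> : (1 + m) *+ (i == j) - (1 + 3 * m) * w%:C - (far_dyad X i j)%:C =
    ((i == j)%:R - v - far_dyad X i j - (w - v))%:C + (m *+ (i == j) - 3 * m * w%:C).
  by rewrite !rmorphB/=; case: eqP => _ /=; rewrite ?mulr1n ?mulr0n ?rmorph1 ?rmorph0; ring.
have n3 : normc (3 : C) = 3.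
  by rewrite -(rmorph_nat (real_complex R)) normc_real ger0_norm.
apply: le_trans (le_normcD _ _) _; rewrite normc_real.
have h1 : `|(i == j)%:R - v - far_dyad X i j - (w - v)| <= 22 * E.
  by apply: le_trans (ler_normB _ _) _; clear -fd wE; lra.
have h2 : normc (m *+ (i == j)) <= 3 * E.
  by case: eqP => _; rewrite ?mulr1n// mulr0n Normc.normc0 mulr_ge0.
have h3 : normc (3 * m * w%:C) <= 18 * E.
  rewrite 2!Normc.normcM n3 normc_real.
  have -> : 18 * E = 3 * (3 * E) * 2 by ring.
  by apply: ler_pM => //; [rewrite mulr_ge0// normc_ge0|rewrite ler_wpM2l].
have h4 := normcB_le (m *+ (i == j)) (3 * m * w%:C).
by clear -h1 h2 h3 h4 E0; lra.
Qed.

Lemma normc_sum_le n (f : 'I_n -> C) : normc (\sum_l f l) <= \sum_l normc (f l).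
Proof.
elim/big_ind2 : _ => [|x x' y y' hx hy|//]; first by rewrite Normc.normc0.
by apply: le_trans (le_normcD _ _) _; exact: lerD.
Qed.

Lemma normr_far_dyad (X : R * R) (i j : 'I_3) : `|X.1| <= 1 -> `|X.2| <= 1 ->
  `|far_dyad X i j| <= 1.
Proof.
by case: i => [[|[|[|//]]] Hi]; case: j => [[|[|[|//]]] Hj]; rewrite /far_dyad/=
  ?normr0 ?normr1.
Qed.

(** The matrix agrees with a projection to first order, so it is idempotent up to quadratic terms.
    Hence the product of two Green tensors has the same limiting matrix as a single one. *)
Lemma far_dyad_sqr A E (X : R * R) (i j : 'I_3) : 0 <= E -> A ^+ 2 <= E ->
  `|X.1| <= A -> `|X.2| <= A -> (i < 2)%N ->
  `|\sum_(l < 3) far_dyad X i l * far_dyad X l j - far_dyad X i j| <= E.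
Proof.
move=> E0 AE X1 X2; have XX (x y : R) : `|x| <= A -> `|y| <= A -> `|x * y| <= E.
  by move=> xA yA; rewrite normrM; apply: le_trans AE; rewrite expr2 ler_pM.
rewrite !big_ord_recr big_ord0/= add0r.
case: i => [[|[|[|//]]] Hi] //= _; case: j => [[|[|[|//]]] Hj]; rewrite /far_dyad/=
  ?mul1r ?mul0r ?mulr1 ?mulr0 ?add0r ?addr0 ?subr0 ?subrr ?normr0//;
  rewrite ?[1 + _ - 1]addrAC ?subrr ?add0r; exact: XX.
Qed.

Lemma conj_mxE m n (M : 'M[C]_(m, n)) i j : conj_mx M i j = conjc (M i j).
Proof. exact: mxE. Qed.

Lemma green_product_scale (e e' d d' : C) (r r' : R) : r != 0 -> r' != 0 ->
  ((4 * pi) ^+ 2)%:C * (conjc (e / (4 * pi * r)%:C * d) * (e' / (4 * pi * r')%:C * d'))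
  = conjc e * e' * (r^-1 * r'^-1)%:C * (conjc d * d').
Proof.
move=> r0 r0'; have cE (x y : C) : conjc (x * y) = conjc x * conjc y by exact: rmorphM.
have VE (x : R) : (x%:C)^-1 = (x^-1)%:C by rewrite fmorphV.
have p0 : pi != 0 :> R by rewrite gt_eqF// pi_gt0.
rewrite !VE !cE conjc_real.
have -> (x y z w : C) (a b c : R) :
    a%:C * (x * b%:C * y * (z * c%:C * w)) = x * z * (a * b * c)%:C * (y * w).
  by rewrite !rmorphM/=; ring.
by congr (_ * _%:C * _); move: (pi : R) p0 => p p0; field; rewrite r0 r0'.
Qed.

(** The kernel splits into phase, amplitude 1 / (r r') and matrix product, each close to a limit of
    modulus at most 1: the phase costs 2 * 100 E, the amplitude 17 E, the matrix 3 * 103 E + E. *)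
Lemma kernel_far Q A B H E (far : far_regime Q A B H E) X Y Y' Z Z' (i j : 'I_3)
    (phi := Q * (Z' - Z) - Q * (X.1 * (Y'.1 - Y.1) + X.2 * (Y'.2 - Y.2))) :
  in_box A B H X Y Z -> in_box A B H X Y' Z' -> (i < 2)%N ->
  normc (((4 * pi) ^+ 2)%:C *
      (conj_mx (dyadic_green Q (point3 X 0) (point3 Y Z))
       *m dyadic_green Q (point3 X 0) (point3 Y' Z')) i j -
    expi phi * (far_dyad X i j)%:C) <= 1000 * E.
Proof.
move=> b b' i2; have E0 := far_E0 far; have [A1 _ _ _] := far_lt far.
have [Z9 Zr _ _ r1] := range_far far b; have [Z9' Zr' _ _ r1'] := range_far far b'.
have ph := phase_far far b b'; rewrite -/phi in ph.
have df l := dyad_far far i l b; have df' l := dyad_far far l j b'.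
case: far (b) => [_ [AE _ _ _ E1] _] [[X1 X2] _ _].
have A1' : A <= 1 by clear -A1; lra.
have fd1 (p q : 'I_3) : `|far_dyad X p q| <= 1.
  by apply: normr_far_dyad; exact: le_trans A1'.
have EE : E * E <= E * (1 / 1000) by exact: ler_wpM2l.
set r := range Y Z X in Zr r1 ph df; set r' := range Y' Z' X in Zr' r1' ph df'.
have r0 : 0 < r by clear -Z9 Zr; lra.
have r0' : 0 < r' by clear -Z9' Zr'; lra.
set D := dyad Q Y Z X i in df; pose D' l := dyad Q Y' Z' X l j.
have -> : ((4 * pi) ^+ 2)%:C *
      (conj_mx (dyadic_green Q (point3 X 0) (point3 Y Z))
       *m dyadic_green Q (point3 X 0) (point3 Y' Z')) i j =
    expi (Q * (r' - r)) * (r^-1 * r'^-1)%:C * \sum_l conjc (D l) * D' l.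
  rewrite mxE !mulr_sumr; apply: eq_bigr => l _.
  rewrite conj_mxE; apply: etrans (congr2 (fun g g' => ((4 * pi) ^+ 2)%:C * (conjc g * g'))
    (dyadic_green_entry Q Y Z X i l) (dyadic_green_entry Q Y' Z' X l j)) _.
  apply: (etrans (green_product_scale _ _ _ _ _ _)); rewrite ?gt_eqF// conjc_expiM.
  by have -> : Q * r' - Q * r = Q * (r' - r) by ring.
have hK l : normc (conjc (D l) * D' l - (far_dyad X i l)%:C * (far_dyad X l j)%:C) <= 103 * E.
  apply: (@le_trans _ _ (50 * E + 50 * E + 50 * E * (50 * E))); last by clear -EE E0; lra.
  apply: normcM_close; rewrite ?normc_real//; last exact: df'.
  by rewrite -[(far_dyad X i l)%:C]conjc_real -rmorphB normcJ; exact: df.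
have hS : normc (\sum_(l < 3) conjc (D l) * D' l - (far_dyad X i j)%:C) <= 310 * E.
  have sq := far_dyad_sqr j E0 AE X1 X2 i2.
  have -> : \sum_(l < 3) conjc (D l) * D' l - (far_dyad X i j)%:C =
     \sum_(l < 3) (conjc (D l) * D' l - (far_dyad X i l)%:C * (far_dyad X l j)%:C) +
     (\sum_(l < 3) far_dyad X i l * far_dyad X l j - far_dyad X i j)%:C.
    rewrite rmorphB rmorph_sum/= sumrB; under [X in _ - X + _]eq_bigr do rewrite -rmorphM.
    by rewrite addrA subrK.
  apply: le_trans (le_normcD _ _) _; rewrite normc_real.
  apply: (@le_trans _ _ (309 * E + E)); last by clear; lra.
  apply: lerD => //; apply: le_trans (normc_sum_le _) _.
  apply: (@le_trans _ _ (\sum_(l < 3) 103 * E)); first exact: ler_sum.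
  by rewrite sumr_const card_ord -mulr_natl; clear; lra.
have hA : normc (expi (Q * (r' - r)) * (r^-1 * r'^-1)%:C - expi phi * 1) <= 221 * E.
  apply: (@le_trans _ _ (200 * E + 17 * E + 200 * E * (17 * E))); last by clear -EE E0; lra.
  apply: normcM_close; rewrite ?normc_expi ?Normc.normc1//.
    by apply: le_trans (expiB_le _ _) _; clear -ph; lra.
  rewrite -(rmorph1 (real_complex R)) -rmorphB normc_real -[1]mulr1.
  apply: (@le_trans _ _ (8 * E + 8 * E + 8 * E * (8 * E))); last by clear -EE E0; lra.
  by apply: normrM_close; rewrite ?normr1.
rewrite mulr1 in hA.
apply: (@le_trans _ _ (221 * E + 310 * E + 221 * E * (310 * E))); last by clear -EE E0; lra.
by apply: normcM_close; rewrite ?normc_expi ?normc_real.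
Qed.

End Kernel.

(** * Far-field expansion of H *)

Section Imaging.
Local Open Scope complex_scope.
Context {R : realType}.
Local Notation C := R[i].
Local Notation normc := Normc.normc.
Implicit Types (Q A B H E k L z : R) (u x : R * R).

Definition unscale L x : R * R := (x.1 / L, x.2 / L).

Lemma range_unscale L u z x : 0 < L ->
  range (unscale L u) (z / L) (unscale L x) = range u z x / L.
Proof.
move=> L0; rewrite /range /unscale/= -!mulrBl !exprMn -!mulrDl.
rewrite sqrtrM ?addr_ge0 ?sqr_ge0//; congr (_ * _).
by rewrite sqrtr_sqr ger0_norm// invr_ge0 ltW.
Qed.

Lemma offset_unscale L u z x (i : 'I_3) :
  offset (unscale L u) (z / L) (unscale L x) i = offset u z x i / L.
Proof.
by rewrite /offset; case: i => [[|[|[|//]]] Hi] /=; rewrite ?mulrBl ?mulNr.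
Qed.

(** The Green tensor is homogeneous of degree -1 when lengths are multiplied by [L] and the
    wavenumber is divided by it; this justifies measuring lengths in units of [L]. *)
Lemma dyadic_green_unscale k L u z x (i j : 'I_3) : 0 < L -> 0 < z ->
  dyadic_green k (point3 x 0) (point3 u z) i j = (L^-1)%:C *
  dyadic_green (k * L) (point3 (unscale L x) 0) (point3 (unscale L u) (z / L)) i j.
Proof.
move=> L0 z0; apply: (etrans (dyadic_green_entry k u z x i j)).
apply: etrans (congr1 (fun g => (L^-1)%:C * g) (esym (dyadic_green_entry (k * L)
  (unscale L u) (z / L) (unscale L x) i j))).
have r0 := lt_le_trans z0 (range_ge u x z0).
have nz : L != 0 by rewrite gt_eqF.
have rE : k * L * (range u z x / L) = k * range u z x by field.
rewrite /dyad range_unscale// !offset_unscale rE.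
have -> : ((range u z x / L) ^+ 2)^-1 * (offset u z x i / L * (offset u z x j / L)) =
  (range u z x ^+ 2)^-1 * (offset u z x i * offset u z x j).
  by field; rewrite nz gt_eqF.
have VE (t : R) : (t%:C)^-1 = (t^-1)%:C by rewrite fmorphV.
have p0 : pi != 0 :> R by rewrite gt_eqF// pi_gt0.
rewrite !VE mulrA; congr (_ * _).
rewrite mulrCA -rmorphM; congr (_ * _%:C).
by move: (pi : R) p0 => p p0; field; rewrite p0 nz gt_eqF.
Qed.

Lemma conj_mulmxE m n p (M : 'M[C]_(m, n)) (N : 'M[C]_(n, p)) i j :
  (conj_mx M *m N) i j = \sum_l conjc (M i l) * N l j.
Proof. by rewrite mxE; apply: eq_bigr => l _; rewrite conj_mxE. Qed.

Lemma kernel_unscale k L u u' z z' x (i j : 'I_3) : 0 < L -> 0 < z -> 0 < z' ->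
  (conj_mx (dyadic_green k (point3 x 0) (point3 u z))
       *m dyadic_green k (point3 x 0) (point3 u' z')) i j =
  (L ^- 2)%:C * (conj_mx (dyadic_green (k * L) (point3 (unscale L x) 0)
                                   (point3 (unscale L u) (z / L)))
       *m dyadic_green (k * L) (point3 (unscale L x) 0)
                             (point3 (unscale L u') (z' / L))) i j.
Proof.
move=> L0 z0 z0'; apply: etrans (conj_mulmxE _ _ i j) _.
apply: etrans (congr1 (fun w => (L ^- 2)%:C * w) (esym (conj_mulmxE _ _ i j))).
rewrite mulr_sumr; apply: eq_bigr => l _.
apply: etrans (congr2 (fun g g' => conjc g * g')
  (dyadic_green_unscale k u x i l L0 z0) (dyadic_green_unscale k u' x l j L0 z0')) _.
have cE (v w : C) : conjc (v * w) = conjc v * conjc w by exact: rmorphM.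
rewrite cE conjc_real.
have -> (v w : C) (t : R) : t%:C * v * (t%:C * w) = (t * t)%:C * (v * w).
  by rewrite rmorphM/=; ring.
by congr (_%:C * _); rewrite -expr2 exprVn.
Qed.

(** The integral over the array of the limiting kernel, in physical coordinates: [t] is the phase
    due to the range offset, and [t1], [t2] are the frequencies seen along the array. *)
Definition far_field (D : set (plane R)) L (t t1 t2 : R) (i j : nat) : C :=
  cintegral D (fun x => expi (t + t1 * x.1 + t2 * x.2) *
                        (far_dyad (unscale L x) i j)%:C).

Section Array.
Variables (D : set (plane R)) (M : R).
Hypotheses (mD : @measurable _ (plane R) D) (Doo : (lebesgue2 R D < +oo)%E).
Hypothesis DM : forall x, D x -> `|x.1| <= M /\ `|x.2| <= M.

Lemma bounded_measurableC_far_field L t t1 t2 (i j : 'I_3) :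
  bounded_measurableC D (fun x => expi (t + t1 * x.1 + t2 * x.2) *
                        (far_dyad (unscale L x) i j)%:C).
Proof.
have b1 : bounded_measurable D (fun x => x.1).
  by apply: (@bounded_measurable_fst _ _ M) => x /DM[].
have b2 : bounded_measurable D (fun x => x.2).
  by apply: (@bounded_measurable_snd _ _ M) => x /DM[].
have bc (c : R) : bounded_measurable D (fun=> c) by exact: bounded_measurable_cst.
apply: bounded_measurableCM.
  apply: bounded_measurableC_expi.
  apply: (proj1 (_ : bounded_measurable D _)).
  by apply: bounded_measurableD; [apply: bounded_measurableD|];
    rewrite //; exact: bounded_measurableM.
apply: bounded_measurableC_real.
by case: i => [[|[|[|//]]] Hi]; case: j => [[|[|[|//]]] Hj];
  rewrite /far_dyad /unscale/= //; exact: bounded_measurableM.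
Qed.

(** The pointwise kernel error integrates to a multiple of the area, so dividing by the area later
    gives a bound that ignores the shape of the array. The 2 in 2000 = 2 * 1000 comes from real and
    imaginary parts. *)
Lemma Hmx_far Q A B H E (far : far_regime Q A B H E) k L u u' z z' (i j : 'I_3) :
  0 < L -> 0 < z -> 0 < z' -> Q = k * L ->
  (forall x, D x -> in_box A B H (unscale L x) (unscale L u) (z / L)) ->
  (forall x, D x -> in_box A B H (unscale L x) (unscale L u') (z' / L)) ->
  (i < 2)%N ->
  normc (((4 * pi * L) ^+ 2)%:C * Hmx D k (point3 u z) (point3 u' z') i j -
    far_field D L (k * (z' - z)) (- (k * (u'.1 - u.1) / L)) (- (k * (u'.2 - u.2) / L)) i j)
  <= 2000 * E * fine (lebesgue2 R D).
Proof.
move=> L0 z0 z0' QE b b' i2; rewrite {}QE in far; have nz : L != 0 by rewrite gt_eqF.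
rewrite /Hmx /mxintegral mxE /far_field.
set t := k * (z' - z).
set t1 := - (k * (u'.1 - u.1) / L); set t2 := - (k * (u'.2 - u.2) / L).
have bf := bounded_measurableC_far_field L t t1 t2 i j.
have bg := bounded_measurableC_green2 DM k u u' i j z0 z0'.
rewrite -cintegralZ//.
set f := (fun x => expi _ * _) in bf *.
set g := (fun x => _%:C * _).
have bcg : bounded_measurableC D g.
  by apply: bounded_measurableCM => //; exact: bounded_measurableC_cst.
have -> : cintegral D g - cintegral D f = cintegral D (fun x => g x + -1 * f x).
  rewrite cintegralD// ?cintegralZ ?mulN1r//.
  by apply: bounded_measurableCM => //; exact: bounded_measurableC_cst.
have -> : 2000 * E = 2 * (1000 * E) by ring.
apply: normc_cintegral_le => //.
  apply: bounded_measurableCD => //.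
  by apply: bounded_measurableCM => //; exact: bounded_measurableC_cst.
move=> x Dx; rewrite mulN1r.
pose w := (conj_mx (dyadic_green (k * L) (point3 (unscale L x) 0)
                                   (point3 (unscale L u) (z / L)))
       *m dyadic_green (k * L) (point3 (unscale L x) 0)
                             (point3 (unscale L u') (z' / L))) i j.
have gE : g x = ((4 * pi) ^+ 2)%:C * w.
  apply: etrans (congr1 (fun w => ((4 * pi * L) ^+ 2)%:C * w)
    (kernel_unscale k u u' x i j L0 z0 z0')) _.
  rewrite mulrA -rmorphM; congr (_%:C * _).
  by move: (pi : R) => p; field.
have fE : f x = expi (k * L * (z' / L - z / L) - k * L *
    ((unscale L x).1 * ((unscale L u').1 - (unscale L u).1) +
     (unscale L x).2 * ((unscale L u').2 - (unscale L u).2))) *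
    (far_dyad (unscale L x) i j)%:C.
  by congr (expi _ * _); rewrite /t /t1 /t2 /unscale/=; field.
by rewrite gE fE; exact: (kernel_far far j (b x Dx) (b' x Dx) i2).
Qed.

(** Restricted to two columns: the third one is the first moment of the array, which need not vanish
    in general. *)
Lemma far_field_stationary L (i j : 'I_3) : (i < 2)%N -> (j < 2)%N ->
  far_field D L 0 0 0 i j = (i == j)%:R * (fine (lebesgue2 R D))%:C.
Proof.
move=> i2 j2; rewrite -cintegral_cst//; congr cintegral; apply/funext => x.
have -> : 0 + 0 * x.1 + 0 * x.2 = 0 :> R by ring.
have -> : expi 0 = 1 :> C by rewrite /expi cos0 sin0.
rewrite mul1r; case: i i2 => [[|[|//]] Hi] _; case: j j2 => [[|[|//]] Hj] _;
  by rewrite /far_dyad/= ?rmorph1 ?rmorph0.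
Qed.

End Array.
End Imaging.

(** * Averages over a disk array and normalization of H *)

Section DiskImaging.
Local Open Scope complex_scope.
Context {R : realType}.
Local Notation C := R[i].
Local Notation normc := Normc.normc.
Implicit Types (Q A B H E k L z : R) (u x : R * R).

Lemma norm2Z (c : R) u : norm2 (c * u.1, c * u.2) = `|c| * norm2 u.
Proof.
by rewrite /norm2/= !exprMn -mulrDr sqrtrM ?sqr_ge0// sqrtr_sqr.
Qed.

Lemma normr_disk_le (a : R) u : disk a u -> `|u.1| <= a /\ `|u.2| <= a.
Proof. by move=> ua; have [h1 h2] := norm2_ge u; split; exact: le_trans ua. Qed.

Lemma far_dyad_affine (a L : R) (i j : 'I_3) : 0 < a -> a <= L -> (i < 2)%N ->
  exists w w1 w2 : R, `|w| + `|w1| * a + `|w2| * a <= 1 /\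
    forall x, far_dyad (unscale L x) i j = w + w1 * x.1 + w2 * x.2.
Proof.
move=> a0 aL; have L0 : 0 < L by exact: lt_le_trans aL.
have VL : `|L^-1| * a <= 1.
  by rewrite normfV (gtr0_norm L0) mulrC ler_pdivrMr// mul1r.
case: i => [[|[|//]] Hi] _; case: j => [[|[|[|//]]] Hj]; rewrite /far_dyad /unscale/=.
- by exists 1, 0, 0; rewrite normr1 normr0 mul0r !addr0; split=> // x; ring.
- by exists 0, 0, 0; rewrite normr0 mul0r !addr0; split=> // x; ring.
- by exists 0, L^-1, 0; rewrite normr0 mul0r add0r addr0; split=> // x; ring.
- by exists 0, 0, 0; rewrite normr0 mul0r !addr0; split=> // x; ring.
- by exists 1, 0, 0; rewrite normr1 normr0 mul0r !addr0; split=> // x; ring.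
- by exists 0, 0, L^-1; rewrite normr0 mul0r !add0r; split=> // x; ring.
Qed.

Lemma far_field_disk_decay (a L t t1 t2 : R) (i j : 'I_3) : 0 < a -> a <= L ->
  (i < 2)%N ->
  norm2 (t1, t2) * normc (far_field (disk a) L t t1 t2 i j) <= 32 * a.
Proof.
move=> a0 aL i2; have [w [w1 [w2 [W fdE]]]] := far_dyad_affine j a0 aL i2.
have ReE : complex.Re (far_field (disk a) L t t1 t2 i j) =
    \int[lebesgue2 R]_(x in disk a) plane_wave w w1 w2 t t1 t2 x.
  apply: eq_Rintegral => x _; rewrite fdE ReM/= mulr0 subr0 mulrC.
  by [].
(* A sine is a cosine with phase shifted by a quarter period, so the same bound serves both
   parts. *)
have ImE : complex.Im (far_field (disk a) L t t1 t2 i j) =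
    \int[lebesgue2 R]_(x in disk a) plane_wave w w1 w2 (t - pi / 2) t1 t2 x.
  apply: eq_Rintegral => x _; rewrite fdE ImM/= mulr0 add0r mulrC /plane_wave.
  congr (_ * _).
  rewrite (_ : t - pi / 2 + _ + _ = t + t1 * x.1 + t2 * x.2 - pi / 2); last by ring.
  by rewrite cosB cos_pihalf sin_pihalf mulr0 mulr1 add0r.
have hb (s : R) : norm2 (t1, t2) *
    `|\int[lebesgue2 R]_(x in disk a) plane_wave w w1 w2 s t1 t2 x| <= 16 * a.
  apply: le_trans (disk_wave w w1 w2 s t1 t2 a0) _.
  by rewrite -[leRHS]mulr1 ler_wpM2l// mulr_ge0// ltW.
apply: le_trans (ler_wpM2l (norm2_ge0 _) (normc_le _)) _.
rewrite ReE ImE mulrDr (_ : 32 * a = 16 * a + 16 * a); last by ring.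
exact: lerD.
Qed.

Lemma far_field_disk_odd (a L : R) (i : 'I_3) : 0 < a -> (i < 2)%N ->
  far_field (disk a) L 0 0 0 i 2 = 0.
Proof.
move=> a0 i2; have a0' := ltW a0.
have mD := measurable_disk a0'; have [Doo _] := lebesgue2_disk a0.
have [odd1 odd2] := disk_odd a0.
have ffE (f : plane R -> R) : bounded_measurable (disk a) f ->
    \int[lebesgue2 R]_(x in disk a) f x = 0 ->
    cintegral (disk a) (fun x => (L^-1)%:C * (f x)%:C) = 0.
  move=> bf f0; rewrite cintegralZ//; last exact: bounded_measurableC_real.
  rewrite (_ : cintegral _ _ = 0) ?mulr0//.
  apply/eqP; rewrite eq_complex/= f0; under eq_Rintegral do rewrite /=.
  by rewrite Rintegral_cst// mul0r !eqxx.
have wave0 (s : plane R) : expi (0 + 0 * s.1 + 0 * s.2) = 1 :> C.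
  by rewrite !mul0r !addr0 /expi cos0 sin0.
rewrite /far_field; under eq_fun do rewrite wave0 mul1r.
case: i i2 => [[|[|//]] Hi] _; rewrite /far_dyad /unscale/=.
- under eq_fun do rewrite mulrC rmorphM/=.
  by apply: ffE => //; exact: bounded_measurable_disk_fst.
- under eq_fun do rewrite mulrC rmorphM/=.
  by apply: ffE => //; exact: bounded_measurable_disk_snd.
Qed.

(* [Hmx] divided by its leading-order diagonal value [mu D / (4 pi L)^2]. *)
Definition normalized_H (D : set (plane R)) k L (y y' : 'cV[R]_3) : 'M[C]_3 :=
  ((4 * pi * L) ^+ 2 / fine (lebesgue2 R D))%:C *: Hmx D k y y'.

Lemma normalized_H_far (D : set (plane R)) Q A B H E
  (far : far_regime Q A B H E) M k L u u' z z' (i j : 'I_3)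
  (mD : @measurable _ (plane R) D) (Doo : (lebesgue2 R D < +oo)%E) :
  (forall x, D x -> `|x.1| <= M /\ `|x.2| <= M) ->
  0 < fine (lebesgue2 R D) -> 0 < L -> 0 < z -> 0 < z' -> Q = k * L ->
  (forall x, D x -> in_box A B H (unscale L x) (unscale L u) (z / L)) ->
  (forall x, D x -> in_box A B H (unscale L x) (unscale L u') (z' / L)) ->
  (i < 2)%N ->
  normc (normalized_H D k L (point3 u z) (point3 u' z') i j -
    ((fine (lebesgue2 R D))^-1)%:C *
    far_field D L (k * (z' - z)) (- (k * (u'.1 - u.1) / L)) (- (k * (u'.2 - u.2) / L)) i j)
  <= 2000 * E.
Proof.
move=> DM m0 L0 z0 z0' QE b b' i2.
have h := Hmx_far mD Doo DM far j L0 z0 z0' QE b b' i2.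
rewrite /normalized_H mxE rmorphM/=; set c := (_ ^+ 2)%:C; set v := (_^-1)%:C.
rewrite -(mulrA c) (mulrCA c) -mulrBr.
rewrite Normc.normcM normc_real.
by rewrite normfV gtr0_norm// mulrC ler_pdivrMr.
Qed.

Lemma normalized_H_diag (D : set (plane R)) Q A B H E
  (far : far_regime Q A B H E) M k L u z (i j : 'I_3)
  (mD : @measurable _ (plane R) D) (Doo : (lebesgue2 R D < +oo)%E) :
  (forall x, D x -> `|x.1| <= M /\ `|x.2| <= M) ->
  0 < fine (lebesgue2 R D) -> 0 < L -> 0 < z -> Q = k * L ->
  (forall x, D x -> in_box A B H (unscale L x) (unscale L u) (z / L)) ->
  (i < 2)%N -> (j < 2)%N ->
  normc (normalized_H D k L (point3 u z) (point3 u z) i j - (i == j)%:R) <= 2000 * E.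
Proof.
move=> DM m0 L0 z0 QE b i2 j2.
have := normalized_H_far far j mD Doo DM m0 L0 z0 z0 QE b b i2.
rewrite !subrr !(mulr0, mul0r) oppr0 far_field_stationary//.
have nm : fine (lebesgue2 R D) != 0 by rewrite gt_eqF.
by rewrite mulrCA -rmorphM/= mulVf// mulr1.
Qed.

(** Unlike its version for general arrays, this covers the third column, through which the range
    entries of a polarizability enter the cross-range block of H alpha H^T. *)
Lemma normalized_H_disk_diag Q A B H E (far : far_regime Q A B H E)
  a k L u z (i j : 'I_3) :
  0 < a -> 0 < L -> 0 < z -> Q = k * L ->
  (forall x, disk a x -> in_box A B H (unscale L x) (unscale L u) (z / L)) ->
  (i < 2)%N ->
  normc (normalized_H (disk a) k L (point3 u z) (point3 u z) i j - (i == j)%:R)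
    <= 2000 * E.
Proof.
move=> a0 L0 z0 QE b i2; have a0' := ltW a0.
have mD := measurable_disk a0'; have [Doo ma] := lebesgue2_disk a0.
have m0 := lt_le_trans (exprn_gt0 2 a0) ma.
have [j2|j2] := ltnP j 2.
  exact: (normalized_H_diag far mD Doo (@normr_disk_le a)).
have := normalized_H_far far j mD Doo (@normr_disk_le a) m0 L0 z0 z0 QE b b i2.
rewrite !subrr !(mulr0, mul0r) oppr0.
have -> : nat_of_ord j = 2%N by apply/eqP; rewrite eqn_leq j2 -ltnS ltn_ord.
rewrite far_field_disk_odd// mulr0.
by have -> : (i == j) = false by apply/eqP => ij; rewrite ij ltnNge j2 in i2.
Qed.

Lemma normalized_H_disk_decay Q A B H E (far : far_regime Q A B H E)
  a k L u u' z z' (i j : 'I_3) :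
  0 < a -> a <= L -> 0 < k -> 0 < L -> 0 < z -> 0 < z' -> Q = k * L ->
  (forall x, disk a x -> in_box A B H (unscale L x) (unscale L u) (z / L)) ->
  (forall x, disk a x -> in_box A B H (unscale L x) (unscale L u') (z' / L)) ->
  (i < 2)%N -> 0 < norm2 (u - u') ->
  normc (normalized_H (disk a) k L (point3 u z) (point3 u' z') i j)
    <= 2000 * E + 32 * (L / (a * k * norm2 (u - u'))).
Proof.
move=> a0 aL k0 L0 z0 z0' QE b b' i2 d0; have a0' := ltW a0.
have mD := measurable_disk a0'; have [Doo ma] := lebesgue2_disk a0.
have m0 := lt_le_trans (exprn_gt0 2 a0) ma.
have := normalized_H_far far j mD Doo (@normr_disk_le a) m0 L0 z0 z0' QE b b' i2.
set t := k * _; set t1 := - (k * (u'.1 - u.1) / L); set t2 := - (k * (u'.2 - u.2) / L).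
set h := normalized_H _ _ _ _ _ _ _; set m := fine _ in ma m0 *.
set f := far_field _ _ _ _ _ _ _ => hf.
have -> : h = (h - (m^-1)%:C * f) + (m^-1)%:C * f by rewrite subrK.
apply: le_trans (le_normcD _ _) _; apply: lerD => //.
have := far_field_disk_decay t t1 t2 j a0 aL i2; rewrite -/f.
have -> : norm2 (t1, t2) = k / L * norm2 (u - u').
  rewrite -[k / L]ger0_norm ?divr_ge0 ?ltW// -norm2Z; congr norm2.
  by rewrite /t1 /t2 /=; congr (_, _); ring.
move=> hd; rewrite Normc.normcM normc_real normfV (gtr0_norm m0) mulrC ler_pdivrMr//.
have kd : 0 < k / L * norm2 (u - u') by rewrite mulr_gt0// divr_gt0.
rewrite mulrC -ler_pdivlMr// in hd; apply: le_trans hd _.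
(* The area of the disk is at least [a ^+ 2]; dividing by it turns the numerator [a] into the
   denominator [a] of the resolution ratio. *)
have -> : 32 * a / (k / L * norm2 (u - u')) =
    32 * (L / (a * k * norm2 (u - u'))) * a ^+ 2.
  by move: (norm2 _) d0 => d d0; field; rewrite !gt_eqF.
apply: ler_wpM2l => //; rewrite mulr_ge0// divr_ge0 ?ltW// !mulr_gt0//.
Qed.

End DiskImaging.

(** * Estimated tensors *)

Section EntrywiseBounds.
Local Open Scope complex_scope.
Context {R : realType}.
Local Notation C := R[i].
Local Notation normc := Normc.normc.

(** Entrywise bounds pass to blocks, transposes and products with explicit constants; the Frobenius
    norm is compared with them only at both ends. *)
Definition mxle m n (M : 'M[C]_(m, n)) (e : R) : Prop :=
  forall i j, normc (M i j) <= e.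

Lemma mxleW m n (M : 'M[C]_(m, n)) d e : mxle M d -> d <= e -> mxle M e.
Proof. by move=> Md de i j; exact: le_trans (Md i j) de. Qed.

Lemma mxleD m n (M N : 'M[C]_(m, n)) d e : mxle M d -> mxle N e ->
  mxle (M + N) (d + e).
Proof.
by move=> Md Ne i j; rewrite mxE; apply: le_trans (le_normcD _ _) _; exact: lerD.
Qed.

Lemma mxleM m n p (M : 'M[C]_(m, n)) (N : 'M[C]_(n, p)) d e :
  mxle M d -> mxle N e -> mxle (M *m N) (n%:R * (d * e)).
Proof.
move=> Md Ne i j; rewrite mxE; apply: le_trans (normc_sum_le _) _.
apply: (@le_trans _ _ (\sum_(l < n) d * e)).
  by apply: ler_sum => l _; rewrite Normc.normcM ler_pM ?normc_ge0.
by rewrite sumr_const card_ord mulr_natl.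
Qed.

Lemma mxle_tr m n (M : 'M[C]_(m, n)) e : mxle M e -> mxle M^T e.
Proof. by move=> Me i j; rewrite mxE. Qed.

Lemma mxle_sum m n (I : finType) (P : pred I) (M : I -> 'M[C]_(m, n)) (e : I -> R) :
  (forall i, P i -> mxle (M i) (e i)) ->
  mxle (\sum_(i | P i) M i) (\sum_(i | P i) e i).
Proof.
move=> Me; elim/big_ind2 : _ => [i j|? ? ? ?|//]; last by [exact: mxleD].
by rewrite mxE Normc.normc0.
Qed.

Lemma mxle1 n : mxle (1%:M : 'M[C]_n) 1.
Proof.
by move=> i j; rewrite mxE; case: eqP => _; rewrite ?mulr1n ?mulr0n ?Normc.normc1 ?Normc.normc0.
Qed.

Lemma mxle_mxnorm m n (M : 'M[C]_(m, n)) : mxle M (mxnorm M).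
Proof.
move=> i j; rewrite /mxnorm -[leLHS](ger0_norm (normc_ge0 _)) -sqrtr_sqr.
apply: ler_wsqrtr; rewrite (bigD1 i)//= (bigD1 j)//= -addrA lerDl addr_ge0//.
  by apply: sumr_ge0 => ? _; exact: sqr_ge0.
by apply: sumr_ge0 => ? _; apply: sumr_ge0 => ? _; exact: sqr_ge0.
Qed.

Lemma mxnorm_le (M : 'M[C]_2) e : mxle M e -> mxnorm M <= 2 * e.
Proof.
move=> Me; have e0 : 0 <= e by apply: le_trans (Me 0 0); exact: normc_ge0.
rewrite -[leRHS]ger0_norm ?mulr_ge0// -sqrtr_sqr /mxnorm; apply: ler_wsqrtr.
have sq i j : normc (M i j) ^+ 2 <= e ^+ 2.
  by rewrite ler_sqr ?nnegrE ?normc_ge0.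
rewrite !big_ord_recr !big_ord0/= !add0r.
have := sq ord0 ord0; have := sq ord0 ord_max; have := sq ord_max ord0.
have := sq ord_max ord_max.
rewrite [widen_ord _ _](_ : _ = ord0); last exact: val_inj.
clear; set s1 := normc _; set s2 := normc _; set s3 := normc _; set s4 := normc _.
lra.
Qed.

Let row_bound m n p (M : 'M[C]_(m, n)) (F : 'M[C]_(n, p)) (e : R) i j :
  mxle F e -> normc ((M *m F) i j) <= e * \sum_l normc (M i l).
Proof.
move=> Fe; rewrite mxE mulr_sumr; apply: le_trans (normc_sum_le _) _.
apply: ler_sum => l _; rewrite Normc.normcM mulrC ler_wpM2r//; exact: normc_ge0.
Qed.

(** A vector v with v P = 0 satisfies v = - v (P - 1), so its l1 norm is at most 2 e <= 1/5 of
    itself. Likewise S - 1 = - S (P - 1) for the inverse S, so each row sum s of moduli satisfies s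
    <= 1 + s / 5, whence the 5/4. *)
Lemma mxle_near1 (P : 'M[C]_2) (e : R) : mxle (P - 1%:M) e -> e <= 1 / 10 ->
  P \in unitmx /\ mxle (invmx P - 1%:M) (5 / 4 * e).
Proof.
move=> Pe e1; have e0 : 0 <= e by apply: le_trans (Pe 0 0); exact: normc_ge0.
have s0 m (M : 'M[C]_(m, 2)) i : 0 <= \sum_l normc (M i l).
  by apply: sumr_ge0 => l _; exact: normc_ge0.
have es m (M : 'M[C]_(m, 2)) i :
    e * \sum_l normc (M i l) <= 1 / 10 * \sum_l normc (M i l).
  exact: ler_wpM2r.
have Pu : P \in unitmx.
  rewrite unitmxE unitfE; apply/negP => /det0P[v v0 vP].
  have vE : v = - (v *m (P - 1%:M)) by rewrite mulmxBr vP mulmx1 sub0r opprK.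
  have vj j : normc (v 0 j) <= 1 / 10 * \sum_l normc (v 0 l).
    rewrite {1}vE mxE normcN; apply: le_trans (es _ v 0); exact: row_bound.
  have : \sum_l normc (v 0 l) <= \sum_(l < 2) 1 / 10 * \sum_l normc (v 0 l).
    exact: ler_sum.
  rewrite sumr_const card_ord -mulr_natl => h.
  have v00 : \sum_l normc (v 0 l) = 0.
    by apply/eqP; rewrite eq_le s0 andbT; clear -h; lra.
  move/negP: v0; apply; apply/eqP/rowP => j; rewrite mxE.
  apply: Normc.eq0_normc; apply/eqP; rewrite eq_le normc_ge0 andbT.
  by apply: le_trans (vj j) _; rewrite v00 mulr0.
split=> // i j.
have SE : invmx P - 1%:M = - (invmx P *m (P - 1%:M)).
  by rewrite mulmxBr mulmx1 mulVmx// opprB.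
have Sij l : normc ((invmx P - 1%:M) i l) <= e * \sum_l normc (invmx P i l).
  by rewrite SE mxE normcN; exact: row_bound.
apply: le_trans (Sij j) _; rewrite mulrC ler_wpM2r//.
have : \sum_l normc (invmx P i l) <=
    \sum_l (normc ((1%:M : 'M[C]_2) i l) + e * \sum_l normc (invmx P i l)).
  apply: ler_sum => l _.
  have -> : invmx P i l = 1%:M i l + (invmx P - 1%:M) i l.
    by rewrite -{1}(subrK 1%:M (invmx P)) mxE addrC.
  by apply: le_trans (le_normcD _ _) _; rewrite lerD2l.
have I1 : \sum_l normc ((1%:M : 'M[C]_2) i l) = 1.
  rewrite (bigD1 i)//= big1 ?addr0 => [|l li]; rewrite mxE ?eqxx ?mulr1n ?Normc.normc1//.
  by rewrite eq_sym (negbTE li) mulr0n Normc.normc0.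
rewrite big_split/= I1 sumr_const card_ord -mulr_natl.
by have := es _ (invmx P) i; clear; lra.
Qed.

End EntrywiseBounds.

Section EstimatedTensor.
Local Open Scope complex_scope.
Context {R : realType}.
Local Notation C := R[i].
Local Notation normc := Normc.normc.

(** All three columns are kept since the whole polarizability contributes to the cross-range block
    of the image. *)
Definition top_rows (M : 'M[C]_3) : 'M[C]_(2, 3) := @usubmx C 2 1 3 M.

Lemma top_rowsE (M : 'M[C]_3) i j : top_rows M i j = M (lshift 1 i) j.
Proof. by rewrite mxE. Qed.

Lemma block12E (M : 'M[C]_3) i j : block12 M i j = M (lshift 1 i) (lshift 1 j).
Proof. by rewrite !mxE. Qed.

Lemma block12_sandwich (h al : 'M[C]_3) :
  block12 (h *m al *m h^T) = top_rows h *m al *m (top_rows h)^T.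
Proof.
apply/matrixP => i j; rewrite block12E [LHS]mxE [RHS]mxE.
apply: eq_bigr => l _; congr (_ * _); last by rewrite !mxE.
by rewrite [LHS]mxE [RHS]mxE; apply: eq_bigr => q _; rewrite top_rowsE.
Qed.

(** The image is quadratic in H and is divided by H twice, so the scalar that normalizes H
    cancels. *)
Lemma estimated_tensorE N (D : set (plane R)) (k L M : R) (us : 'I_N -> R * R)
    (zs : 'I_N -> R) (alpha : 'I_N -> 'M[C]_3) v w
    (h := fun n => top_rows (normalized_H D k L (point3 v w) (point3 (us n) (zs n))))
    (S := invmx (block12 (normalized_H D k L (point3 v w) (point3 v w)))) :
  @measurable _ (plane R) D -> (lebesgue2 R D < +oo)%E ->
  (forall x, D x -> `|x.1| <= M /\ `|x.2| <= M) ->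
  0 < fine (lebesgue2 R D) -> 0 < L -> (forall n, 0 < zs n) -> 0 < w ->
  block12 (normalized_H D k L (point3 v w) (point3 v w)) \in unitmx ->
  estimated_tensor D k (fun n => point3 (us n) (zs n)) alpha (point3 v w) =
  S *m (\sum_n h n *m alpha n *m (h n)^T) *m S.
Proof.
move=> mD Doo DM m0 L0 zs0 w0 Su.
pose d : C := (((4 * pi * L) ^+ 2 / fine (lebesgue2 R D))^-1)%:C.
have c0 : (4 * pi * L) ^+ 2 / fine (lebesgue2 R D) != 0.
  by rewrite gt_eqF// divr_gt0// exprn_gt0// !mulr_gt0// pi_gt0.
have d0 : d != 0 by rewrite fmorph_eq0 invr_eq0.
have HE y y' : Hmx D k y y' = d *: normalized_H D k L y y'.
  by rewrite /normalized_H scalerA -rmorphM mulVf// scale1r.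
have bZ (c : C) (X : 'M[C]_3) : block12 (c *: X) = c *: block12 X.
  by apply/matrixP => i j; rewrite !mxE.
have dd (X Y : 'M[C]_3) : (d *: X) *m Y *m (d *: X)^T = (d * d) *: (X *m Y *m X^T).
  have -> : (d *: X)^T = d *: X^T by apply/matrixP => i j; rewrite !mxE.
  by rewrite -!scalemxAl -scalemxAr scalerA.
rewrite /estimated_tensor (kirchhoff_imageE DM mD Doo k us alpha v zs0 w0).
rewrite HE bZ invmxZ; last by rewrite unitmxZ// unitfE.
rewrite -/S -!scalemxAl -!scalemxAr !scalerA.
have -> : block12 (\sum_n Hmx D k (point3 v w) (point3 (us n) (zs n)) *m alpha n
     *m (Hmx D k (point3 v w) (point3 (us n) (zs n)))^T) =
    (d * d) *: \sum_n h n *m alpha n *m (h n)^T.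
  rewrite scaler_sumr; apply/matrixP => i j.
  rewrite block12E !summxE; apply: eq_bigr => n _.
  by rewrite HE dd -block12E bZ block12_sandwich !mxE.
rewrite -scalemxAr -scalemxAl scalerA.
have -> : d^-1 / d * (d * d) = 1 by rewrite mulrACA mulVf// mulr1.
by rewrite scale1r.
Qed.

End EstimatedTensor.

(** * Propagation of errors to the estimated tensor *)

Section TensorErrors.
Local Open Scope complex_scope.
Context {R : realType}.
Local Notation C := R[i].
Local Notation normc := Normc.normc.

Lemma mxle_sandwich (S T : 'M[C]_2) (e tau : R) : mxle (S - 1%:M) (5 / 4 * e) ->
  e <= 1 / 10 -> mxle T tau -> mxle (S *m T *m S) (16 * tau).
Proof.
move=> Se e1 Tt; have S2 : mxle S 2.
  rewrite -(subrK 1%:M S); apply: mxleW (mxleD Se (@mxle1 _ 2)) _.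
  by clear -e1; lra.
apply: mxleW (mxleM (mxleM S2 Tt) S2) _; rewrite le_eqVlt; apply/orP; left.
by apply/eqP; ring.
Qed.

Lemma mxle_quadratic (U : 'M[C]_(2, 3)) (al : 'M[C]_3) (g c : R) :
  mxle U g -> mxle al c -> mxle (U *m al *m U^T) (9 * g ^+ 2 * c).
Proof.
move=> Ug alc; apply: mxleW (mxleM (mxleM Ug alc) (mxle_tr Ug)) _.
by rewrite le_eqVlt; apply/orP; left; apply/eqP; ring.
Qed.

Lemma mxle_block12 (al : 'M[C]_3) c : mxle al c -> mxle (block12 al) c.
Proof. by move=> alc i j; rewrite block12E. Qed.

(** Telescoping makes the error linear in [e], with 27 = 18 + 9; this is why the error terms of (i)
    are not squared. *)
Lemma mxle_quadratic_near (U : 'M[C]_(2, 3)) (al : 'M[C]_3) (e c : R) :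
  mxle (U - top_rows 1%:M) e -> e <= 1 -> mxle al c ->
  mxle (U *m al *m U^T - block12 al) (27 * (e * c)).
Proof.
move=> Ue e1 alc; set J := top_rows 1%:M in Ue.
have JE : block12 al = J *m al *m J^T.
  by rewrite -block12_sandwich trmx1 mulmx1 mul1mx.
have J1 : mxle J 1 by move=> i j; rewrite top_rowsE; exact: mxle1.
have U2 : mxle U 2.
  by rewrite -(subrK J U); apply: mxleW (mxleD Ue J1) _; clear -e1; lra.
have -> : U *m al *m U^T - block12 al =
    (U - J) *m al *m U^T + J *m al *m (U - J)^T.
  by rewrite JE linearB/= mulmxBr !mulmxBl addrA subrK.
apply: mxleW (mxleD (mxleM (mxleM Ue alc) (mxle_tr U2))
  (mxleM (mxleM J1 alc) (mxle_tr Ue))) _.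
by rewrite le_eqVlt; apply/orP; left; apply/eqP; ring.
Qed.

Lemma mxle_sandwich_near (S T a : 'M[C]_2) (e tau c : R) :
  mxle (S - 1%:M) (5 / 4 * e) -> e <= 1 / 10 -> mxle (T - a) tau -> mxle a c ->
  mxle (S *m T *m S - a) (16 * tau + 25 / 2 * (e * c)).
Proof.
move=> Se e1 Tt ac; have S2 : mxle S 2.
  rewrite -(subrK 1%:M S); apply: mxleW (mxleD Se (@mxle1 _ 2)) _.
  by clear -e1; lra.
have -> : S *m T *m S - a =
    S *m (T - a) *m S + ((S - 1%:M) *m a *m S + a *m (S - 1%:M)).
  rewrite mulmxBr !mulmxBl mul1mx mulmxBr mulmx1.
  by rewrite -!addrA; congr (_ + _); rewrite !addrA addNr add0r addNr add0r.
apply: mxleD; first exact: mxle_sandwich Se e1 Tt.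
apply: mxleW (mxleD (mxleM (mxleM Se ac) S2) (mxleM ac Se)) _.
by rewrite le_eqVlt; apply/orP; left; apply/eqP; field.
Qed.

Variables (N : nat) (h : 'I_N -> 'M[C]_(2, 3)) (S : 'M[C]_2)
  (alpha : 'I_N -> 'M[C]_3) (e c : R) (g : 'I_N -> R).
Hypotheses (Se : mxle (S - 1%:M) (5 / 4 * e)) (e1 : e <= 1 / 10)
  (ac : forall n, mxle (alpha n) c).

(** Every scatterer acts through two small factors, hence the squares; 288 = 2 * 16 * 9 collects the
    Frobenius norm, the two inverses and the product of three matrices. *)
Lemma tensor_error_away : (forall n, mxle (h n) (g n)) ->
  mxnorm (S *m (\sum_n h n *m alpha n *m (h n)^T) *m S) <=
  288 * c * \sum_n g n ^+ 2.
Proof.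
move=> hg; have := @mxle_sum R 2 2 'I_N predT _ _ (fun n _ => mxle_quadratic (hg n) (ac n)).
move=> /(mxle_sandwich Se e1)/mxnorm_le; rewrite -mulr_suml -mulr_sumr.
by move/le_trans; apply; rewrite le_eqVlt; apply/orP; left; apply/eqP; ring.
Qed.

Lemma tensor_error_at (i : 'I_N) : mxle (h i - top_rows 1%:M) e ->
  (forall n, n != i -> mxle (h n) (g n)) ->
  mxnorm (S *m (\sum_n h n *m alpha n *m (h n)^T) *m S - block12 (alpha i)) <=
  900 * (e * c) + 288 * c * \sum_(n | n != i) g n ^+ 2.
Proof.
move=> hi hg; have e1' : e <= 1 by apply: le_trans e1 _; lra.
have hs := @mxle_sum R 2 2 'I_N (fun n => n != i) _ _
    (fun n ni => mxle_quadratic (hg n ni) (ac n)).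
have hT : mxle (\sum_n h n *m alpha n *m (h n)^T - block12 (alpha i))
    (27 * (e * c) + \sum_(n | n != i) 9 * g n ^+ 2 * c).
  rewrite (bigD1 i)//= addrAC; apply: mxleD => //.
  exact: mxle_quadratic_near (ac i).
have e0 : 0 <= e by apply: le_trans (hi 0 0); exact: normc_ge0.
have c0 : 0 <= c by apply: le_trans (ac i 0 0); exact: normc_ge0.
(* The coefficient of [e * c] is 2 (16 * 27 + 25/2) = 889, rounded up to 900. *)
have := mxnorm_le (mxle_sandwich_near Se e1 hT (mxle_block12 (ac i))).
move=> /le_trans; apply; rewrite -mulr_suml -mulr_sumr.
by have : 0 <= e * c by [exact: mulr_ge0]; move: (\sum_(_ | _) _) => s; lra.
Qed.

End TensorErrors.

(** * The resolution term and the choice of the error parameter *)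

Section Resolution.
Local Open Scope complex_scope.
Context {R : realType}.
Implicit Types (k L a : R).

(** Positivity of all the distances makes the minimum positive; at a zero minimum the convention
    0^-1 = 0 would make the term vanish and break the inequality. *)
Lemma resolution_term_ge N k L a (y : R * R) (ys : 'I_N -> R * R) (P : pred 'I_N) j :
  0 < k -> 0 < L -> 0 < a -> P j -> (forall n, P n -> 0 < norm2 (y - ys n)) ->
  (L / (a * k * norm2 (y - ys j))) ^+ 2 <= resolution_term k L a y ys P.
Proof.
move=> k0 L0 a0 Pj d0; rewrite /resolution_term.
case: pickP => [j0 Pj0|/(_ j)]; last by rewrite Pj.
set m := \big[_/_]_(_ | _) _.
have m0 : 0 < m by apply: lt_bigmin => //; exact: d0.
have mj : m <= norm2 (y - ys j) by exact: bigmin_le_cond.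
have ak0 : 0 < a * k by exact: mulr_gt0.
have dj := lt_le_trans m0 mj.
have Vpos (d : R) : 0 < d -> 0 <= L / (a * k * d).
  by move=> d0'; apply: divr_ge0; apply: ltW => //; exact: mulr_gt0.
rewrite ler_sqr ?nnegrE; [|exact: Vpos..].
apply: ler_wpM2l; first exact: ltW.
by rewrite lef_pV2 ?posrE ?mulr_gt0// ler_pM2l.
Qed.

Lemma resolution_term_ge0 N k L a (y : R * R) (ys : 'I_N -> R * R) (P : pred 'I_N) :
  0 <= resolution_term k L a y ys P.
Proof. by rewrite /resolution_term; case: pickP => [? _|_]; rewrite ?sqr_ge0. Qed.

Lemma norm2_gt0 (x : R * R) : x <> 0 -> 0 < norm2 x.
Proof.
move=> x0; rewrite lt_neqAle norm2_ge0 andbT eq_sym; apply/negP => /eqP n0.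
have [] := norm2_ge x; rewrite n0 !normr_le0 => /eqP x1 /eqP x2.
by apply: x0; rewrite (surjective_pairing x) x1 x2.
Qed.

(** Here [p] is kL, the ratios a / L, b / L, h / L are [al], [be], [ch], and [c] bounds kh. Each
    requirement of the regime costs one coefficient times a term of the error, and [K'] is the sum
    of these eight coefficients. *)
Lemma far_regime_normalized (p al be ch K M c : R) : 0 < p -> 0 <= al ->
  0 <= be -> 0 <= ch -> 0 <= K -> 0 <= M -> 0 <= c ->
  1 <= p * al ^+ 2 -> be <= 1 -> p * ch <= c ->
  let K' := 1 + M ^+ 2 + K + K * c + K ^+ 2 + M ^+ 4 + K * c * M ^+ 2 + K ^+ 3 * c in
  let E := K' * (p * be ^+ 2 + p * al ^+ 4 + be) in
  E <= 1 / 1000 -> far_regime p (M * al) (K * be) (K * ch) E.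
Proof.
move=> p0 al0 be0 ch0 K0 M0 c0 pal be1 pch K' E E1.
set s := p * al ^+ 4; set tb := p * be ^+ 2.
have s0 : 0 <= s by rewrite mulr_ge0 ?exprn_ge0// ltW.
have tb0 : 0 <= tb by rewrite mulr_ge0 ?exprn_ge0// ltW.
have K2 : 0 <= K ^+ 2 by exact: exprn_ge0.
have K3 : 0 <= K ^+ 3 by exact: exprn_ge0.
have M2 : 0 <= M ^+ 2 by exact: exprn_ge0.
have M4 : 0 <= M ^+ 4 by exact: exprn_ge0.
have Kc : 0 <= K * c by exact: mulr_ge0.
have KcM : 0 <= K * c * M ^+ 2 by exact: mulr_ge0.
have K3c : 0 <= K ^+ 3 * c by exact: mulr_ge0.
have boundE (q r : R) : q <= K' -> 0 <= r -> r <= tb + s + be -> q * r <= E.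
  move=> qK r0 rs; apply: (@le_trans _ _ (K' * r)); first exact: ler_wpM2r.
  by apply: ler_wpM2l => //; rewrite /K'; clear -K0 K2 K3 M2 M4 Kc KcM K3c; lra.
have al_s : al ^+ 2 <= s.
  have -> : s = al ^+ 2 * (p * al ^+ 2) by rewrite /s; ring.
  by rewrite -{1}[al ^+ 2]mulr1 ler_wpM2l// exprn_ge0.
have qK : [/\ M ^+ 2 <= K', K <= K', K * c <= K' & [/\ 1 <= K', K ^+ 2 <= K',
     M ^+ 4 <= K', K * c * M ^+ 2 <= K' & K ^+ 3 * c <= K']].
  by rewrite /K'; split; [| | |split]; clear -K0 K2 K3 M2 M4 Kc KcM K3c; lra.
case: qK => q1 q2 q3 [q4 q5 q6 q7 q8].
have rs : s <= tb + s + be by clear -tb0 be0; lra.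
have rt : tb <= tb + s + be by clear -s0 be0; lra.
have rb : be <= tb + s + be by clear -s0 tb0; lra.
(* Two factors p al^2 >= 1 are inserted: ch <= ch (p al^2)^2 = (p ch) s, and p ch is at most [c]. *)
have ch_s : ch <= c * s.
  have h1 : ch * 1 <= ch * (p * al ^+ 2) by exact: ler_wpM2l.
  have h2 : ch * (p * al ^+ 2) * 1 <= ch * (p * al ^+ 2) * (p * al ^+ 2).
    by apply: ler_wpM2l => //; rewrite mulr_ge0// mulr_ge0 ?exprn_ge0// ltW.
  have h3 : p * ch * s <= c * s by exact: ler_wpM2r.
  have E3 : p * ch * s = ch * (p * al ^+ 2) * (p * al ^+ 2) by rewrite /s; ring.
  by rewrite E3 in h3; clear -h1 h2 h3; lra.
have al20 : 0 <= al ^+ 2 by exact: exprn_ge0.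
split; split=> //.
- exact: mulr_ge0.
- exact: mulr_ge0.
- exact: mulr_ge0.
- by rewrite exprMn; apply: boundE => //; exact: le_trans rs.
- exact: boundE.
- apply: (@le_trans _ _ (K * (c * s))); first exact: ler_wpM2l.
  by rewrite mulrA; exact: boundE.
- have h1 : 1 <= p * s.
    have -> : p * s = (p * al ^+ 2) * (p * al ^+ 2) by rewrite /s; ring.
    by rewrite mulr_ege1.
  apply: le_trans h1 _; apply: ler_wpM2l; first exact: ltW.
  by rewrite -[s]mul1r; exact: boundE.
- have -> : p * (K * be) ^+ 2 = K ^+ 2 * tb by rewrite /tb; ring.
  exact: boundE.
- have -> : p * (M * al) ^+ 4 = M ^+ 4 * s by rewrite /s; ring.
  exact: boundE.
- have -> : p * (K * ch * (M * al) ^+ 2) = K * (p * ch) * (M ^+ 2 * al ^+ 2) by ring.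
  apply: (@le_trans _ _ (K * c * (M ^+ 2 * al ^+ 2))).
    by apply: ler_wpM2r; [rewrite mulr_ge0|exact: ler_wpM2l].
  by rewrite mulrA; apply: boundE => //; exact: le_trans rs.
- have -> : p * (K * ch * (K * be) ^+ 2) = K ^+ 3 * (p * ch) * be ^+ 2 by ring.
  apply: (@le_trans _ _ (K ^+ 3 * c * be ^+ 2)).
    by apply: ler_wpM2r; [exact: exprn_ge0|exact: ler_wpM2l].
  apply: boundE => //; first exact: exprn_ge0.
  by apply: le_trans rb; rewrite expr2 ler_piMl.
Qed.

End Resolution.

(** * The Fraunhofer regime *)

Section Regime.
Local Open Scope complex_scope.
Context {R : realType}.

Definition far_error (k L a b : R) : R :=
  Theta k L b + a ^+ 2 * Theta k L a / L ^+ 2 + b / L.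

(** The passage from the limit to fixed parameters: [K'] depends only on [K], [M] and the bound on
    kh, so the later constants are uniform over the window. *)
Lemma fraunhofer_far_regime (T : Type) (F : set_system T) (FF : ProperFilter F)
    (k L a b h : T -> R) (regime : fraunhofer F k L a b h) (K M : R) :
  0 <= K -> 0 <= M -> exists2 K' : R, 0 <= K' & \forall t \near F,
  [/\ far_regime (k t * L t) (M * (a t / L t)) (K * (b t / L t)) (K * (h t / L t))
        (K' * far_error (k t) (L t) (a t) (b t)),
      2000 * (K' * far_error (k t) (L t) (a t) (b t)) <= 1 / 10,
      a t <= L t & b t <= L t].
Proof.
move=> K0 M0; case: regime => [[k0 L0 a0 b0 h0] [_ aL bL _] [Tb0 Ta0 s0] [c hc]].
pose c' := `|c|.
pose K' := 1 + M ^+ 2 + K + K * c' + K ^+ 2 + M ^+ 4 + K * c' * M ^+ 2 + K ^+ 3 * c'.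
have K'1 : 1 <= K'.
  rewrite /K' -!addrA lerDl !addr_ge0 ?mulr_ge0 ?exprn_ge0 ?normr_ge0//.
have K'0 : 0 < K' by exact: lt_le_trans K'1.
exists K'; first exact: ltW.
(* Each of the three error terms will be at most dl / K', so that K' times the error is at most 3
   dl, below both 1/1000 and 1/20000. *)
have [dl dl0 dlE] : exists2 dl : R, 0 < dl & 2000 * dl <= 1 / 100.
  by exists (1 / 2000 * (1 / 100)); lra.
pose d := dl / K'; have d0 : 0 < d by exact: divr_gt0.
have near_le (X Y : T -> R) (e : R) : 0 < e -> much_less F X Y -> (forall t, 0 <= X t / Y t) ->
    \forall t \near F, X t / Y t <= e.
  move=> e0 /cvgr0_norm_le/(_ _ e0) XY pos; apply: filterS XY => t.
  by rewrite ger0_norm.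
have Tpos s t : 0 < s t -> 0 < Theta (k t) (L t) (s t).
  by move=> st; rewrite /Theta divr_gt0// mulr_gt0// exprn_gt0.
have n1 := near_le _ _ _ ltr01 aL (fun t => divr_ge0 (ltW (a0 t)) (ltW (L0 t))).
have n2 := near_le _ _ _ ltr01 bL (fun t => divr_ge0 (ltW (b0 t)) (ltW (L0 t))).
have n3 := near_le _ _ _ d0 bL (fun t => divr_ge0 (ltW (b0 t)) (ltW (L0 t))).
have n4 := near_le _ _ _ d0 Tb0 (fun t => divr_ge0 (ltW (Tpos _ _ (b0 t))) ler01).
have n5 := near_le _ _ _ ltr01 Ta0 (fun t => divr_ge0 ler01 (ltW (Tpos _ _ (a0 t)))).
have n6 := near_le _ _ _ d0 s0 (fun t => divr_ge0 (ltW (Tpos _ _ (a0 t)))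
  (divr_ge0 (sqr_ge0 _) (sqr_ge0 _))).
near=> t.
have q1 : a t / L t <= 1 by near: t; exact: n1.
have q2 : b t / L t <= 1 by near: t; exact: n2.
have q3 : b t / L t <= d by near: t; exact: n3.
have q4 : Theta (k t) (L t) (b t) / 1 <= d by near: t; exact: n4.
have q5 : 1 / Theta (k t) (L t) (a t) <= 1 by near: t; exact: n5.
have q6 : Theta (k t) (L t) (a t) / (L t ^+ 2 / a t ^+ 2) <= d by near: t; exact: n6.
have q7 : `|k t * h t| <= c by near: t; exact: hc.
have Lt := L0 t; have at0 := a0 t; have kt := k0 t; have bt := b0 t; have ht := h0 t.
have nL : L t != 0 by rewrite gt_eqF.
have na : a t != 0 by rewrite gt_eqF.
have nk : k t != 0 by rewrite gt_eqF.
have TaE : k t * L t * (a t / L t) ^+ 2 = Theta (k t) (L t) (a t).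
  by rewrite /Theta; field.
have EE : far_error (k t) (L t) (a t) (b t) =
    k t * L t * (b t / L t) ^+ 2 + k t * L t * (a t / L t) ^+ 4 + b t / L t.
  by rewrite /far_error /Theta; field.
have E3 : far_error (k t) (L t) (a t) (b t) <= d + d + d.
  rewrite /far_error; apply: lerD => //; apply: lerD; first by rewrite divr1 in q4.
  apply: le_trans q6; rewrite le_eqVlt; apply/orP; left; apply/eqP.
  by rewrite /Theta; field; rewrite na nL.
have KE : K' * far_error (k t) (L t) (a t) (b t) <= 3 * dl.
  apply: le_trans (ler_wpM2l (ltW K'0) E3) _.
  by rewrite /d le_eqVlt; apply/orP; left; apply/eqP; field; rewrite gt_eqF.
split; last 2 first.
- by move: q1; rewrite ler_pdivrMr// mul1r.
- by move: q2; rewrite ler_pdivrMr// mul1r.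
- have EE1 : K' * far_error (k t) (L t) (a t) (b t) <= 1 / 1000.
    by apply: le_trans KE _; clear -dlE dl0; lra.
  rewrite EE in EE1 *.
  apply: far_regime_normalized => //.
  + exact: mulr_gt0.
  + by rewrite divr_ge0// ltW.
  + by rewrite divr_ge0// ltW.
  + by rewrite divr_ge0// ltW.
  + exact: normr_ge0.
  + by rewrite TaE; move: q5; rewrite ler_pdivrMr ?mul1r// Tpos.
  + have -> : k t * L t * (h t / L t) = k t * h t by field.
    by apply: le_trans (ler_norm _) _; apply: le_trans q7 _; exact: ler_norm.
- by clear -KE dlE; lra.
Unshelve. all: by end_near. Qed.

Lemma in_window_box (cb ch K A b h L eta : R) (x y : R * R) : 0 < L -> 0 < b -> 0 < h ->
  cb <= K -> ch <= K -> `|x.1| <= A -> `|x.2| <= A ->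
  in_window cb ch b h y eta ->
  in_box (A / L) (K * (b / L)) (K * (h / L)) (unscale L x) (unscale L y)
    ((L + eta) / L).
Proof.
move=> L0 b0 h0 cbK chK x1 x2 [yb eh]; have [y1 y2] := norm2_ge y.
have div (u v : R) : `|u| <= v -> `|u / L| <= v / L.
  by move=> uv; rewrite normrM normfV (gtr0_norm L0) ler_wpM2r// invr_ge0 ltW.
have yK : norm2 y <= K * b by apply: le_trans yb _; rewrite ler_wpM2r// ltW.
split.
- by split; exact: div.
- by rewrite !mulrA; split; apply: div; [exact: le_trans yK|exact: le_trans yK].
- have -> : (L + eta) / L - 1 = eta / L by field; rewrite gt_eqF.
  rewrite mulrA; apply: div; apply: le_trans eh _; by rewrite ler_wpM2r// ltW.
Qed.

(** The window lies strictly in front of the array, so the Green tensor stays away from its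
    singularity. *)
Lemma in_box_depth (Q A B H E : R) (far : far_regime Q A B H E) X Y L z :
  0 < L -> in_box A B H X Y (z / L) -> 0 < z.
Proof.
move=> L0 b; have [Z9 _ _ _ _] := range_far far b.
have : 0 < z / L by clear -Z9; lra.
by rewrite pmulr_lgt0// invr_gt0.
Qed.

End Regime.

(** * Measurability and area of dilated arrays *)

Section Arrays.
Local Open Scope complex_scope.
Context {R : realType}.

Lemma scaled_arrayE (a : R) (A : set (R * R)) : 0 < a ->
  scaled_array a A = [set x | A (x.1 / a, x.2 / a)].
Proof.
move=> a0; have na : a != 0 by rewrite gt_eqF.
apply/seteqP; split=> [_ [[x y] Axy <-]|[x y] Axy] /=.
  by have -> : a * x / a = x by [field]; have -> : a * y / a = y by [field].
exists (x / a, y / a) => //=.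
by have -> : a * (x / a) = x by [field]; have -> : a * (y / a) = y by [field].
Qed.

Lemma measurable_scaled_array (a : R) (A : set (R * R)) : 0 < a ->
  bounded_domain A -> @measurable _ (plane R) (scaled_array a A).
Proof.
move=> a0 [_ [U [_ oU _ AU]]]; rewrite scaled_arrayE//.
have mA : @measurable _ (plane R) A.
  by case: AU => ->; [exact: open_measurable2|apply: closed_measurable2; exact: closed_closure].
pose f (x : plane R) : plane R := (x.1 / a, x.2 / a).
have mf : measurable_fun setT f.
  by apply: measurable_fun_pair; apply: measurable_funM.
by have := mf measurableT A mA; rewrite setTI.
Qed.

Lemma bounded_scaled_array (A : set (R * R)) : bounded_domain A ->
  exists2 M : R, 0 < M & forall a x, 0 < a -> scaled_array a A x ->
    `|x.1| <= M * a /\ `|x.2| <= M * a.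
Proof.
move=> [/pinfty_ex_gt0[M M0 AM] _]; exists M => // a x a0.
move=> [y /AM yM <-] /=.
have : `|y.1| <= M /\ `|y.2| <= M.
  by split; apply: le_trans yM; rewrite prod_normE le_max lexx ?orbT.
by rewrite !normrM (gtr0_norm a0) => -[h1 h2]; rewrite ![a * _]mulrC !ler_wpM2r// ltW.
Qed.

Lemma scaled_array_area (a : R) (A : set (R * R)) : 0 < a -> bounded_domain A ->
  (lebesgue2 R (scaled_array a A) < +oo)%E /\
  0 < fine (lebesgue2 R (scaled_array a A)).
Proof.
move=> a0 bA; have mA := measurable_scaled_array a0 bA.
have [M M0 AM] := bounded_scaled_array bA.
have Aoo : (lebesgue2 R (scaled_array a A) < +oo)%E.
  apply: le_lt_trans (lebesgue2_square_le _ mA (fun x => AM a x a0)) (ltry _).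
  by rewrite mulr_ge0// ltW.
split=> //; apply: fine_gt0; rewrite Aoo andbT.
case: bA => _ [U [[p Up] oU _ AU]].
have UA : U `<=` A by case: AU => ->; [|exact: subset_closure].
have /nbhs_ballP[e e0 eU] := open_nbhs_nbhs (conj oU Up).
(* Balls of the sup norm are squares, so a closed square of half-side e / 2 fits in the open set,
   and its dilation has area (a e)^2. *)
pose I (q : R) := `[a * (q - e / 2), a * (q + e / 2)]%classic.
have aI q : lebesgue_measure (I q) = (a * e)%:E.
  rewrite lebesgue_measure_itv/= lte_fin ltr_pM2l// ifT.
    by rewrite -EFinD; congr EFin; field.
  by rewrite ltrD2l; move: e0 => /=; clear; lra.
have : (0 < lebesgue2 R (I p.1 `*` I p.2))%E.
  rewrite product_measure1E//; try exact: measurable_itv.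
  by rewrite /= !aI -EFinM lte_fin !mulr_gt0.
move=> /lt_le_trans; apply; apply: le_measure.
- by rewrite inE; apply: measurableX; exact: measurable_itv.
- by rewrite inE.
move=> x [] /=; rewrite /I/= !in_itv/= => /andP[h1 h2] /andP[h3 h4].
rewrite scaled_arrayE//=; apply/UA/eU.
have hh (s q : R) : a * (q - e / 2) <= s -> s <= a * (q + e / 2) -> `|q - s / a| < e.
  move=> l u; have : q - e / 2 <= s / a by rewrite ler_pdivlMr// mulrC.
  have : s / a <= q + e / 2 by rewrite ler_pdivrMr// mulrC.
  move: (s / a) e0 => w /= {l u}; clear; rewrite ltr_norml => *.
  by apply/andP; split; lra.
by split; rewrite /ball/=; exact: hh.
Qed.

End Arrays.

(** * Solvability of the system and final inequalities *)

Section Estimates.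
Local Open Scope complex_scope.
Context {R : realType}.
Local Notation C := R[i].
Local Notation normc := Normc.normc.

Lemma block12_near1 (h : 'M[C]_3) (e : R) :
  (forall i j : 'I_3, (i < 2)%N -> (j < 2)%N -> normc (h i j - (i == j)%:R) <= e) ->
  mxle (block12 h - 1%:M) e.
Proof.
move=> he i j; rewrite mxE block12E mxE [X in _ - X]mxE.
by apply: he => /=; exact: ltn_ord.
Qed.

Lemma top_rows_near (h : 'M[C]_3) (e : R) :
  (forall i j : 'I_3, (i < 2)%N -> normc (h i j - (i == j)%:R) <= e) ->
  mxle (top_rows h - top_rows 1%:M) e.
Proof.
move=> he i j; rewrite mxE top_rowsE mxE top_rowsE [X in _ - X]mxE.
by apply: he => /=; exact: ltn_ord.
Qed.

Lemma block12_Hmx_unit (D : set (plane R)) (k L : R) (y y' : 'cV[R]_3) :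
  0 < L -> 0 < fine (lebesgue2 R D) ->
  block12 (normalized_H D k L y y') \in unitmx -> block12 (Hmx D k y y') \in unitmx.
Proof.
move=> L0 m0; rewrite /normalized_H.
set c := (_ / _)%:C; have c0 : c != 0.
  by rewrite fmorph_eq0 gt_eqF// divr_gt0// exprn_gt0// !mulr_gt0// pi_gt0.
rewrite (_ : block12 _ = c *: block12 (Hmx D k y y')) ?unitmxZ ?unitfE//.
by apply/matrixP => i j; rewrite !mxE.
Qed.

Lemma sandwich_solution (H Y : 'M[C]_2) : H \in unitmx ->
  bijective (fun X : 'M[C]_2 => H *m X *m H) /\
  forall X, H *m X *m H = Y <-> X = invmx H *m Y *m invmx H.
Proof.
move=> Hu; split; first exists (fun X => invmx H *m X *m invmx H) => X.
- by rewrite !mulmxA mulVmx// mul1mx mulmxK.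
- by rewrite !mulmxA mulmxV// mul1mx mulmxKV.
by move=> X; split=> [<-|->]; rewrite !mulmxA ?mulVmx ?mulmxV// mul1mx ?mulmxK ?mulmxKV.
Qed.

(* The window term [b / L] of (i) is absorbed by the two terms of (ii). *)
Lemma window_ratio_le (k L a b K d : R) : 0 < k -> 0 < L -> 0 < a -> 0 < b -> 0 < K ->
  0 < d -> a <= L -> b <= L -> d <= 4 * (K * b) ->
  b / L <= 4 * K * (L / (a * k * d)) + Theta k L b.
Proof.
move=> k0 L0 a0 b0 K0 d0 aL bL dK; have rho0 : 0 <= L / (a * k * d).
  by rewrite divr_ge0// ?ltW// !mulr_gt0.
have K0' := ltW K0.
(* If kb >= 1 then b <= k b^2, and Theta_b suffices. If kb < 1 the window is below the wavelength
   scale: a k d <= 4 K a (kb) <= 4 K L, so the resolution ratio times 4 K is at least 1 >= b / L. *)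
have [kb|kb] := lerP 1 (k * b).
  apply: ler_wpDl; first by apply: mulr_ge0 => //; exact: mulr_ge0.
  rewrite /Theta ler_wpM2r ?invr_ge0 ?(ltW L0)//.
  have -> : k * b ^+ 2 = k * b * b by ring.
  by rewrite ler_peMl// ltW.
apply: ler_wpDr; first by apply: divr_ge0; [apply: mulr_ge0; [exact: ltW|exact: sqr_ge0]|exact: ltW].
apply: (@le_trans _ _ 1); first by rewrite ler_pdivrMr// mul1r.
rewrite mulrA ler_pdivlMr ?mulr_gt0// mul1r.
have K40 : 0 <= 4 * K by exact: mulr_ge0.
have h1 : a * k * d <= a * k * (4 * (K * b)).
  by apply: ler_wpM2l => //; apply: mulr_ge0; exact: ltW.
have h2 : a * k * (4 * (K * b)) = 4 * K * a * (k * b) by ring.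
rewrite {}h2 in h1; apply: le_trans h1 _.
apply: (@le_trans _ _ (4 * K * a * 1)).
  by apply: ler_wpM2l; [apply: mulr_ge0 => //|]; exact: ltW.
by rewrite mulr1; exact: ler_wpM2l.
Qed.

Lemma norm2B_le (x y : R * R) : norm2 (x - y) <= 2 * (norm2 x + norm2 y).
Proof.
have [x1 x2] := norm2_ge x; have [y1 y2] := norm2_ge y.
have -> : 2 * (norm2 x + norm2 y) = (norm2 x + norm2 y) + (norm2 x + norm2 y) by ring.
apply: le_trans (norm2_le _) _.
by apply: lerD; apply: le_trans (ler_normB _ _) _; exact: lerD.
Qed.

(** In (i) the error of the other scatterers may be linear in [e], which is present anyway; 2048 = 2
    * 32^2. *)
Lemma sqrD_small_le (e r : R) : 0 <= e -> e <= 1 / 10 ->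
  (e + 32 * r) ^+ 2 <= e + 2048 * r ^+ 2.
Proof.
move=> e0 e1; have ee : e * e <= e * (1 / 10) by exact: ler_wpM2l.
by have := sqr_ge0 (e - 32 * r); clear -ee e0; lra.
Qed.

Lemma sqrD3_le (x y z : R) : (x + y + z) ^+ 2 <= 3 * (x ^+ 2 + y ^+ 2 + z ^+ 2).
Proof.
by have := sqr_ge0 (x - y); have := sqr_ge0 (y - z); have := sqr_ge0 (x - z); lra.
Qed.

End Estimates.

Theorem proposition3p2 (R : realType) (T : Type) (F : set_system T)
    (FF : ProperFilter F) (k L a b h : T -> R)
    (regime : fraunhofer F k L a b h)
    (N : nat) (N_gt0 : (0 < N)%N) (cb ch calpha : R) :
  (forall Atilde : set (R * R), bounded_domain Atilde ->
    \forall t \near F,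
      forall (ys : 'I_N -> R * R) (etas : 'I_N -> R)
             (alpha : 'I_N -> 'M[R[i]]_3) (y : R * R) (eta : R),
      (forall j, in_window cb ch (b t) (h t) (ys j) (etas j)) ->
      (forall j, (alpha j)^T = alpha j) ->
      (forall j, mxnorm (alpha j) <= calpha) ->
      in_window cb ch (b t) (h t) y eta ->
      let A := scaled_array (a t) Atilde in
      let yvec := point3 y (L t + eta) in
      let yvecs := fun j => point3 (ys j) (L t + etas j) in
      let H := block12 (Hmx A (k t) yvec yvec) in
      let I_KM := block12 (kirchhoff_image A (k t) yvecs alpha yvec) in
      [/\ H \in unitmx,
          bijective (fun X : 'M[R[i]]_2 => H *m X *m H)
        & forall X : 'M[R[i]]_2,
            H *m X *m H = I_KM <-> X = invmx H *m I_KM *m invmx H])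
  /\
  (exists c : R, \forall t \near F,
      forall (ys : 'I_N -> R * R) (etas : 'I_N -> R)
             (alpha : 'I_N -> 'M[R[i]]_3),
      (forall j, in_window cb ch (b t) (h t) (ys j) (etas j)) ->
      (forall j, (alpha j)^T = alpha j) ->
      (forall j, mxnorm (alpha j) <= calpha) ->
      let yvecs := fun j => point3 (ys j) (L t + etas j) in
      let alpha_est := estimated_tensor (disk (a t)) (k t) yvecs alpha in
      let Theta_a := Theta (k t) (L t) (a t) in
      let Theta_b := Theta (k t) (L t) (b t) in
      (forall i : 'I_N, (forall j, j != i -> ys j <> ys i) ->
        mxnorm (alpha_est (yvecs i) - block12 (alpha i)) <=
          c * (resolution_term (k t) (L t) (a t) (ys i) ys (fun j => j != i)
               + b t / L t + a t ^+ 2 * Theta_a / L t ^+ 2 + Theta_b))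
      /\
      (forall (y : R * R) (eta : R),
        in_window cb ch (b t) (h t) y eta ->
        (forall j, y <> ys j) ->
        mxnorm (alpha_est (point3 y (L t + eta))) <=
          c * (resolution_term (k t) (L t) (a t) y ys predT
               + a t ^+ 4 * Theta_a ^+ 2 / L t ^+ 4 + Theta_b ^+ 2))).
Proof.
pose K : R := `|cb| + `|ch| + 1.
have K0 : 0 < K by rewrite ltr_wpDl ?addr_ge0.
have cbK : cb <= K by have := ler_norm cb; have := normr_ge0 ch; rewrite /K; clear; lra.
have chK : ch <= K by have := ler_norm ch; have := normr_ge0 cb; rewrite /K; clear; lra.
have [[k0 L0 a0 b0 h0] _ _ _] := regime.
split.
  move=> At bAt; have [M M0 AM] := bounded_scaled_array bAt.
  have [K' _ far_near] := fraunhofer_far_regime FF regime (ltW K0) (ltW M0).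
  refine (filterS _ far_near) => t [far E1 _ _] ys etas alpha y eta _ _ _ yw.
  set A := scaled_array _ _; set H := block12 (Hmx _ _ _ _).
  set I_KM := block12 (kirchhoff_image _ _ _ _ _).
  have mA := measurable_scaled_array (a0 t) bAt.
  have [Aoo m0] := scaled_array_area (a0 t) bAt.
  have AMt x : A x -> `|x.1| <= M * a t /\ `|x.2| <= M * a t by exact: AM.
  have box x : A x -> in_box (M * (a t / L t)) (K * (b t / L t)) (K * (h t / L t))
      (unscale (L t) x) (unscale (L t) y) ((L t + eta) / L t).
    move=> /AMt[x1 x2]; rewrite mulrA.
    exact: (in_window_box (L0 t) (b0 t) (h0 t) cbK chK x1 x2 yw).
  (* A point of the array, which exists because the area is positive, is required to read off that
     the imaging point has positive depth. *)
  have [x Ax] : exists x, A x.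
    apply: contrapT => nA; move: m0; rewrite (_ : scaled_array _ _ = set0).
      by rewrite measure0 ltxx.
    by apply/seteqP; split=> // x Ax; apply: nA; exists x.
  have z0 := in_box_depth far (L0 t) (box x Ax).
  have Hu : H \in unitmx.
    apply: (block12_Hmx_unit (L0 t) m0).
    apply: (proj1 (mxle_near1 (block12_near1 _) E1)) => i j i2 j2.
    exact: (normalized_H_diag far mA Aoo AMt m0 (L0 t) z0 erefl box i2 j2).
  by have [? ?] := sandwich_solution I_KM Hu; split.
have [K' K'0 far_near] := fraunhofer_far_regime FF regime (ltW K0) ler01.
(* With b / L replaced by 4 K rho + Theta_b, the error is at most 2 Theta_b + s + 4 K rho, s being
   a^2 Theta_a / L^2. [G] dominates the coefficients of 2000 K' times this sum plus 32 rho. *)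
pose G : R := 4000 * K' + 8000 * (K * K') + 32.
(* [c1] and [c2] serve (i) and (ii): they combine 900 and 288 of the tensor bounds with [N]
   scatterers, the error 2000 K' of H, the 2048 of the squared decay and the 3 of a squared sum of
   three terms. *)
pose c1 : R := `|calpha| * ((900 + 288 * N%:R) * (2000 * K') + 288 * 2048 * N%:R).
pose c2 : R := 288 * `|calpha| * (N%:R * (3 * G ^+ 2)).
have N0 : 0 <= N%:R :> R by exact: ler0n.
have Kn0 : 0 <= 2000 * K' by apply: mulr_ge0; [exact: ler0n|].
have c10 : 0 <= c1.
  apply: mulr_ge0; first exact: normr_ge0.
  apply: addr_ge0; last by apply: mulr_ge0 N0; apply: mulr_ge0; exact: ler0n.
  apply: mulr_ge0; last exact: Kn0.
  by apply: addr_ge0; [exact: ler0n|apply: mulr_ge0; [exact: ler0n|]].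
have c20 : 0 <= c2.
  apply: mulr_ge0; first by apply: mulr_ge0; [exact: ler0n|exact: normr_ge0].
  apply: mulr_ge0; first exact: N0.
  by apply: mulr_ge0; [exact: ler0n|exact: sqr_ge0].
exists (c1 + c2); refine (filterS _ far_near) => t [far E1 aL bL] ys etas alpha ysw _ alc.
pose yvecs := fun j => point3 (ys j) (L t + etas j).
pose alpha_est := estimated_tensor (disk (a t)) (k t) yvecs alpha.
pose Theta_a := Theta (k t) (L t) (a t).
pose Theta_b := Theta (k t) (L t) (b t).
suff [at_scatterer away] :
    (forall i : 'I_N, (forall j, j != i -> ys j <> ys i) ->
      mxnorm (alpha_est (yvecs i) - block12 (alpha i)) <=
        (c1 + c2) * (resolution_term (k t) (L t) (a t) (ys i) ys (fun j => j != i)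
             + b t / L t + a t ^+ 2 * Theta_a / L t ^+ 2 + Theta_b)) /\
    (forall (y : R * R) (eta : R), in_window cb ch (b t) (h t) y eta ->
      (forall j, y <> ys j) ->
      mxnorm (alpha_est (point3 y (L t + eta))) <=
        (c1 + c2) * (resolution_term (k t) (L t) (a t) y ys predT
             + a t ^+ 4 * Theta_a ^+ 2 / L t ^+ 4 + Theta_b ^+ 2)) by [].
rewrite mul1r in far.
set fe := far_error _ _ _ _ in far E1.
have kt := k0 t; have Lt := L0 t; have at0 := a0 t; have bt := b0 t; have ht := h0 t.
have at0' := ltW at0.
have mD := measurable_disk at0'; have [Doo ma] := lebesgue2_disk at0.
have m0 := lt_le_trans (exprn_gt0 2 at0) ma.
have al0 n : mxle (alpha n) `|calpha|.
  by apply: mxleW (mxle_mxnorm _) _; apply: le_trans (alc n) (ler_norm _).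
have Tb0 : 0 <= Theta_b by rewrite /Theta_b /Theta divr_ge0// ?mulr_ge0 ?sqr_ge0 ?ltW.
have Ta0 : 0 <= a t ^+ 2 * Theta_a / L t ^+ 2.
  by rewrite /Theta_a /Theta !(mulr_ge0, invr_ge0, sqr_ge0)// ltW.
have bL0 : 0 <= b t / L t by rewrite divr_ge0 ?ltW.
have feE : fe = Theta_b + a t ^+ 2 * Theta_a / L t ^+ 2 + b t / L t by [].
have fe0 : 0 <= fe by rewrite feE !addr_ge0.
have e0 : 0 <= 2000 * (K' * fe).
  by apply: mulr_ge0; [exact: ler0n|exact: mulr_ge0].
have box y eta x : in_window cb ch (b t) (h t) y eta -> disk (a t) x ->
    in_box (a t / L t) (K * (b t / L t)) (K * (h t / L t))
      (unscale (L t) x) (unscale (L t) y) ((L t + eta) / L t).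
  move=> yw /normr_disk_le[x1 x2].
  exact: (in_window_box (L0 t) (b0 t) (h0 t) cbK chK x1 x2 yw).
have D0 : disk (a t) 0 by rewrite in_disk//= expr0n/= addr0 sqr_ge0.
have depth y eta : in_window cb ch (b t) (h t) y eta -> 0 < L t + eta.
  by move=> /box/(_ D0)/(in_box_depth far Lt).
pose hn y eta n := normalized_H (disk (a t)) (k t) (L t) (point3 y (L t + eta)) (yvecs n).
pose S y eta := invmx (block12 (normalized_H (disk (a t)) (k t) (L t)
  (point3 y (L t + eta)) (point3 y (L t + eta)))).
have diag y eta : in_window cb ch (b t) (h t) y eta ->
    forall i j : 'I_3, (i < 2)%N ->
    Normc.normc (normalized_H (disk (a t)) (k t) (L t) (point3 y (L t + eta))
      (point3 y (L t + eta)) i j - (i == j)%:R) <= 2000 * (K' * fe).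
  move=> yw i j i2; apply: (normalized_H_disk_diag far j at0 Lt (depth _ _ yw) erefl _ i2).
  by move=> x; exact: box.
have Snear y eta : in_window cb ch (b t) (h t) y eta ->
    block12 (normalized_H (disk (a t)) (k t) (L t) (point3 y (L t + eta))
      (point3 y (L t + eta))) \in unitmx /\
    mxle (S y eta - 1%:M) (5 / 4 * (2000 * (K' * fe))).
  move=> yw; apply: mxle_near1 => //; apply: block12_near1 => i j i2 _.
  exact: diag.
have estE y eta : in_window cb ch (b t) (h t) y eta ->
    alpha_est (point3 y (L t + eta)) =
    S y eta *m (\sum_n top_rows (hn y eta n) *m alpha n *m (top_rows (hn y eta n))^T)
      *m S y eta.
  move=> yw; apply: (@estimated_tensorE R N (disk (a t)) (k t) (L t) (a t) ys
    (fun n => L t + etas n) alpha y (L t + eta) mD Doo (@normr_disk_le _ (a t))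
    m0 Lt (fun n => depth _ _ (ysw n)) (depth _ _ yw)).
  by have [] := Snear _ _ yw.
have decay y eta n : in_window cb ch (b t) (h t) y eta -> 0 < norm2 (y - ys n) ->
    mxle (top_rows (hn y eta n))
      (2000 * (K' * fe) + 32 * (L t / (a t * k t * norm2 (y - ys n)))).
  move=> yw d0 i j; rewrite top_rowsE.
  apply: (normalized_H_disk_decay far j at0 aL kt Lt (depth _ _ yw)
    (depth _ _ (ysw n)) erefl _ _ _ d0).
  - by move=> x; exact: box.
  - by move=> x; exact: box.
  - exact: (ltn_ord i).
split=> [i ysi|y eta yw yys].
- rewrite (estE _ _ (ysw i)).
  have dist_gt0 n : n != i -> 0 < norm2 (ys i - ys n).
    by move=> /ysi ni; apply: norm2_gt0 => /eqP; rewrite subr_eq0 => /eqP/esym.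
  have [_ Sn] := Snear _ _ (ysw i).
  have near_i : mxle (top_rows (hn (ys i) (etas i) i) - top_rows 1%:M) (2000 * (K' * fe)).
    by apply: top_rows_near; exact: diag.
  have := tensor_error_at Sn E1 al0 near_i (fun n ni => decay _ _ n (ysw i) (dist_gt0 n ni)).
  move=> /le_trans; apply.
  set res := resolution_term _ _ _ _ _ _.
  have res0 : 0 <= res by exact: resolution_term_ge0.
  have sumb : \sum_(n | n != i) (2000 * (K' * fe) +
      32 * (L t / (a t * k t * norm2 (ys i - ys n)))) ^+ 2
      <= N%:R * (2000 * (K' * fe) + 2048 * res).
    apply: (@le_trans _ _ (\sum_(n | n != i) (2000 * (K' * fe) + 2048 * res))).
      apply: ler_sum => n ni; apply: le_trans (sqrD_small_le _ e0 E1) _.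
      rewrite lerD2l; apply: ler_wpM2l; first exact: ler0n.
      by apply: (resolution_term_ge (P := fun j => j != i)) => // j; exact: dist_gt0.
    apply: (@le_trans _ _ (\sum_(n < N) (2000 * (K' * fe) + 2048 * res))).
      rewrite [leRHS](bigD1 i) 1?lerDr; last by [].
      by apply: addr_ge0; [exact: e0|apply: mulr_ge0; [exact: ler0n|]].
    by rewrite sumr_const card_ord [leRHS]mulr_natl.
  have -> : res + b t / L t + a t ^+ 2 * Theta_a / L t ^+ 2 + Theta_b = res + fe.
    by rewrite feE; ring.
  apply: (@le_trans _ _ (c1 * (res + fe))); last first.
    by apply: ler_wpM2r; [exact: addr_ge0|rewrite lerDl].
  have := ler_wpM2l (mulr_ge0 (ler0n R 288) (normr_ge0 calpha)) sumb.
  (* [x1] and [x2] are the products of a coefficient with the wrong error term, by which the claimed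
     bound exceeds the proved one. *)
  have x1 : 0 <= `|calpha| * (900 + 288 * N%:R) * (2000 * K') * res.
    apply: mulr_ge0 res0; apply: mulr_ge0 Kn0; apply: mulr_ge0 (normr_ge0 _) _.
    by apply: addr_ge0; [exact: ler0n|apply: mulr_ge0; [exact: ler0n|]].
  have x2 : 0 <= `|calpha| * (288 * 2048 * N%:R) * fe.
    apply: mulr_ge0 fe0; apply: mulr_ge0 (normr_ge0 _) _.
    by apply: mulr_ge0 N0; apply: mulr_ge0; exact: ler0n.
  rewrite /c1; move: (\sum_(_ | _) _) => sm.
  have -> : `|calpha| * ((900 + 288 * N%:R) * (2000 * K') + 288 * 2048 * N%:R) * (res + fe) =
    `|calpha| * (900 + 288 * N%:R) * (2000 * K') * res
    + `|calpha| * (288 * 2048 * N%:R) * fe + 900 * (2000 * (K' * fe) * `|calpha|)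
    + 288 * `|calpha| * (N%:R * (2000 * (K' * fe) + 2048 * res)).
    by ring.
  by clear -x1 x2; lra.
- rewrite (estE _ _ yw).
  have dist_gt0 n : 0 < norm2 (y - ys n).
    by apply: norm2_gt0 => /eqP; rewrite subr_eq0 => /eqP; exact: yys.
  have [_ Sn] := Snear _ _ yw.
  have := tensor_error_away Sn E1 al0 (fun n => decay _ _ n yw (dist_gt0 n)).
  move=> /le_trans; apply.
  set res := resolution_term _ _ _ _ _ _.
  have res0 : 0 <= res by exact: resolution_term_ge0.
  set s := a t ^+ 2 * Theta_a / L t ^+ 2 in Ta0 feE.
  have sE : a t ^+ 4 * Theta_a ^+ 2 / L t ^+ 4 = s ^+ 2.
    have sq (u v w : R) : w != 0 -> u ^+ 4 * v ^+ 2 / w ^+ 4 = (u ^+ 2 * v / w ^+ 2) ^+ 2.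
      by move=> w0; field.
    by apply: sq; rewrite gt_eqF.
  have G0 : 0 <= G.
    apply: addr_ge0; last exact: ler0n.
    by apply: addr_ge0; apply: mulr_ge0; rewrite ?ler0n//; exact: mulr_ge0 (ltW K0) K'0.
  have gb n : (2000 * (K' * fe) + 32 * (L t / (a t * k t * norm2 (y - ys n)))) ^+ 2
      <= 3 * G ^+ 2 * (res + s ^+ 2 + Theta_b ^+ 2).
    set rho := L t / _.
    have rho0 : 0 <= rho by rewrite divr_ge0 ?ltW// !mulr_gt0.
    have rres : rho ^+ 2 <= res.
      by apply: (resolution_term_ge (P := predT)).
    have dK : norm2 (y - ys n) <= 4 * (K * b t).
      have y1 : norm2 y <= K * b t by apply: le_trans yw.1 _; rewrite ler_wpM2r// ltW.
      have y2 : norm2 (ys n) <= K * b t by apply: le_trans (ysw n).1 _; rewrite ler_wpM2r// ltW.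
      by apply: le_trans (norm2B_le _ _) _; clear -y1 y2; lra.
    (* The error of H contains b / L, which the bound of (ii) does not allow; it is traded for the
       other terms before squaring. *)
    have bLb := window_ratio_le kt Lt at0 bt K0 (dist_gt0 n) aL bL dK.
    rewrite -/rho -/Theta_b in bLb.
    have gG : 2000 * (K' * fe) + 32 * rho <= G * (Theta_b + s + rho).
      have h1 : K' * fe <= K' * (2 * Theta_b + s + 4 * K * rho).
        by apply: ler_wpM2l => //; rewrite feE; clear -bLb; lra.
      have KK : 0 <= K * K' by exact: mulr_ge0 (ltW K0) K'0.
      have p1 := mulr_ge0 K'0 Ta0; have p2 := mulr_ge0 K'0 rho0.
      have p3 := mulr_ge0 KK Tb0; have p4 := mulr_ge0 KK Ta0.
      have -> : G * (Theta_b + s + rho) = 2000 * (K' * (2 * Theta_b + s + 4 * K * rho))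
         + 32 * rho + 2000 * (K' * s) + 4000 * (K' * rho) + 8000 * (K * K' * Theta_b)
         + 8000 * (K * K' * s) + 32 * Theta_b + 32 * s by rewrite /G; ring.
      by clear -h1 p1 p2 p3 p4 Tb0 Ta0; lra.
    have g0 : 0 <= 2000 * (K' * fe) + 32 * rho.
      by apply: addr_ge0; [exact: e0|apply: mulr_ge0; [exact: ler0n|]].
    apply: (@le_trans _ _ ((G * (Theta_b + s + rho)) ^+ 2)).
      by rewrite ler_sqr ?nnegrE//; exact: le_trans gG.
    rewrite exprMn.
    have -> : 3 * G ^+ 2 * (res + s ^+ 2 + Theta_b ^+ 2) =
      G ^+ 2 * (3 * (res + s ^+ 2 + Theta_b ^+ 2)) by ring.
    apply: ler_wpM2l; first exact: sqr_ge0.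
    apply: le_trans (sqrD3_le _ _ _) _.
    by clear -rres; lra.
  rewrite sE; apply: (@le_trans _ _ (c2 * (res + s ^+ 2 + Theta_b ^+ 2))); last first.
    by apply: ler_wpM2r; [rewrite !addr_ge0// sqr_ge0|rewrite lerDr].
  have -> : c2 * (res + s ^+ 2 + Theta_b ^+ 2) = 288 * `|calpha| *
     \sum_(n < N) 3 * G ^+ 2 * (res + s ^+ 2 + Theta_b ^+ 2).
    by rewrite sumr_const card_ord -[X in _ = _ * X]mulr_natl /c2; ring.
  apply: ler_wpM2l; first by apply: mulr_ge0; [exact: ler0n|exact: normr_ge0].
  by apply: ler_sum => n _; exact: gb.
Qed.
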